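(* Let $n\ge 1$ and let $\alpha\vDash n$ be a composition. (a) Let $f\in\{\rho,\psi\}$. Then $f(\mathfrak{S}^*_{\alpha})$ has exactly one term when expanded in the dual immaculate basis $\{\mathfrak{S}^*_\beta\}_{\beta\vDash n}$ of $\mathrm{QSym}^n$ if and only if $\alpha$ is a bottom-aligned hook. In this case $$\rho(\mathfrak{S}^*_{\alpha})=\mathfrak{S}^*_{\alpha},\qquad \psi(\mathfrak{S}^*_{\alpha})=\mathfrak{S}^*_{\alpha^t}.$$ (b) $\omega(\mathfrak{S}^*_{\alpha})$ has exactly one term when expanded in the dual immaculate basis if and only if $\alpha$ is a bottom-aligned hook or a top-aligned hook. In these cases $$\omega(\mathfrak{S}^*_{\alpha})=\mathfrak{S}^*_{\alpha^t}.$$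
   Context: A composition $\alpha=(\alpha_1,\dots,\alpha_\ell)\vDash n$ is a finite list of positive integers with sum $n$; $\ell(\alpha)=\ell$. Write $[n-1]=\{1,\dots,n-1\}$ and $\mathrm{Set}(\alpha)=\{\alpha_1,\alpha_1+\alpha_2,\dots,\alpha_1+\cdots+\alpha_{\ell-1}\}\subseteq[n-1]$; $\mathrm{Comp}$ denotes the inverse bijection from subsets of $[n-1]$ to compositions of $n$. The reverse of $\alpha$ is $\alpha^r=(\alpha_\ell,\dots,\alpha_1)$, the complement is $\alpha^c=\mathrm{Comp}([n-1]\setminus\mathrm{Set}(\alpha))$, and the transpose is $\alpha^t=(\alpha^c)^r=(\alpha^r)^c$. A bottom-aligned hook is a composition that is either $(1^n)$ or of the form $(k,1^{\ell-1})$ with $k\ge2$; a top-aligned hook is either $(1^n)$ or of the form $(1^{\ell-1},k)$ with $k\ge 2$. In the variables $x_1,x_2,\dots$, the monomial quasisymmetric function is $M_\alpha=\sum_{i_1<\cdots<i_\ell}x_{i_1}^{\alpha_1}\cdots x_{i_\ell}^{\alpha_\ell}$. $\mathrm{QSym}^n$ is the $\mathbb{Z}$-span of $\{M_\alpha\mid\alpha\vDash n\}$ and $\mathrm{QSym}=\bigoplus_{n\ge0}\mathrm{QSym}^n$ (with $M_\emptyset=1$). The fundamental quasisymmetric functions are $F_\alpha=\sum_{\beta\preceq\alpha}M_\beta$, where $\beta\preceq\alpha$ means that the parts of $\alpha$ are obtained in order by adding adjacent parts of $\beta$; $\{F_\alpha\}_{\alpha\vDash n}$ is a $\mathbb{Z}$-basis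 of $\mathrm{QSym}^n$. The linear maps $\rho,\psi,\omega:\mathrm{QSym}\to\mathrm{QSym}$ are defined by $\rho(F_\alpha)=F_{\alpha^r}$, $\psi(F_\alpha)=F_{\alpha^c}$, $\omega(F_\alpha)=F_{\alpha^t}$. The diagram of $\alpha$ is the left-justified array of cells with $\alpha_i$ cells in row $i$, rows numbered from bottom to top. A semi-standard immaculate tableau of shape $\alpha$ and content $\beta$ is a filling of the diagram of $\alpha$ with positive integers, with $\beta_i$ entries equal to $i$ for each $i$, such that entries strictly increase from bottom to top in the first (leftmost) column and weakly increase from left to right in each row. Let $K_{\alpha,\beta}$ be the number of these. The dual immaculate function is $\mathfrak{S}^*_\alpha=\sum_{\beta\vDash n}K_{\alpha,\beta}M_\beta$; $\{\mathfrak{S}^*_\alpha\}_{\alpha\vDash n}$ is a $\mathbb{Z}$-basis of $\mathrm{QSym}^n$. An element of $\mathrm{QSym}^n$ ''has exactly one term'' in a basis if exactly one basis element has nonzero coefficient in its expansion. *)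

(* Defs.v *)
From HB Require Import structures.
From mathcomp Require Import all_boot all_order all_algebra.
From mathcomp Require Import finmap monalg zify.
From mathcomp Require Import boolp classical_sets functions.

Set Implicit Arguments.
Unset Strict Implicit.
Unset Printing Implicit Defensive.

Import GRing.Theory.
Local Open Scope ring_scope.

Definition is_composition (n : nat) (s : seq nat) : bool :=
  (0 \notin s)%N && (sumn s == n).

Record composition (n : nat) := Composition {
  parts :> seq nat;
  partsP : is_composition n parts
}.

HB.instance Definition _ n := [isSub for @parts n].
HB.instance Definition _ n := [Countable of composition n by <:].

Section CompositionFinite.
Variable n : nat.
Implicit Type a : composition n.

Lemma parts_gt0 a k : k \in parts a -> (0 < k)%N.
Proof. by case: a => s /= /andP[s0 _] ks; rewrite lt0n; apply: contraNneq s0 => <-. Qed.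

Lemma sum_parts a : sumn a = n.
Proof. by case: a => s /= /andP[_ /eqP]. Qed.

Lemma size_le_sumn (s : seq nat) : (0 \notin s)%N -> (size s <= sumn s)%N.
Proof.
elim: s => //= x s IH; rewrite in_cons negb_or eq_sym -lt0n => /andP[x0 /IH]; lia.
Qed.

Lemma le_sumn (s : seq nat) k : k \in s -> (k <= sumn s)%N.
Proof.
by elim: s => //= x s IH; rewrite in_cons => /orP[/eqP->|/IH]; lia.
Qed.

Lemma size_parts_le a : (size a <= n)%N.
Proof. by case: a => s /= /andP[/size_le_sumn h /eqP <-]. Qed.

Definition composition_code a : {bseq n of 'I_n.+1} :=
  insub_bseq n [seq inord k | k <- a].

Definition composition_decode (t : {bseq n of 'I_n.+1}) : option (composition n) :=
  insub [seq nat_of_ord k | k <- t].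

Lemma composition_codeK : pcancel composition_code composition_decode.
Proof.
move=> a; rewrite /composition_decode /composition_code.
rewrite /insub_bseq insubdK ?unfold_in ?size_map ?size_parts_le //.
rewrite -map_comp (_ : map _ _ = parts a); first exact: valK.
rewrite -[RHS]map_id; apply/eq_in_map => k ka /=.
by rewrite inordK // ltnS -(sum_parts a) le_sumn.
Qed.

End CompositionFinite.

HB.instance Definition _ n :=
  @isFinite.Build (composition n) _ (@pcan_enumP _ _ _ _ (@composition_codeK n)).

Section ReverseComplement.

Lemma rev_compositionP n (a : composition n) : is_composition n (rev a).
Proof. by rewrite /is_composition mem_rev sumn_rev; apply: partsP. Qed.

Definition rev_comp n (a : composition n) : composition n :=
  Composition (rev_compositionP a).

(* A subset of [1, n - 1] is represented by the increasing list of its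
   elements. *)
Definition set_of_comp (s : seq nat) : seq nat :=
  [seq sumn (take i s) | i <- iota 1 (size s).-1].

Definition comp_of_set (n : nat) (s : seq nat) : seq nat :=
  if n is 0 then [::] else pairmap (fun x y => y - x)%N 0%N (rcons s n).

Definition is_subset (n : nat) (s : seq nat) : bool :=
  sorted ltn s && all (fun i => 0 < i < n)%N s.

Lemma diffs_gt0 x t : path ltn x t ->
  (0 \notin pairmap (fun x y => y - x)%N x t)%N.
Proof.
elim: t x => //= y t IH x /andP[xy /IH]; rewrite in_cons negb_or => ->.
by rewrite andbT; lia.
Qed.

Lemma path_last x t : path ltn x t -> (x <= last x t)%N.
Proof. by elim: t x => //= y t IH x /andP[xy /IH]; lia. Qed.

Lemma sumn_diffs x t : path ltn x t ->
  sumn (pairmap (fun x y => y - x)%N x t) = (last x t - x)%N.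
Proof.
by elim: t x => [|y t IH] x /=; [lia | move=> /andP[xy p]; rewrite IH //; have := path_last p; lia].
Qed.

Lemma subset_path n s : (0 < n)%N -> is_subset n s -> path ltn 0 (rcons s n).
Proof.
move=> n0 /andP[ss sa]; rewrite rcons_path path_min_sorted ?ss //=; last first.
  by apply/allP => i /(allP sa) /andP[].
by have := mem_last 0%N s; rewrite in_cons => /orP[/eqP->//|/(allP sa) /andP[]].
Qed.

Lemma comp_of_setP n s : is_subset n s -> is_composition n (comp_of_set n s).
Proof.
case: n => [|n] h //; have p := subset_path (ltn0Sn n) h.
by rewrite /is_composition diffs_gt0 // sumn_diffs // last_rcons subn0 eqxx.
Qed.

Lemma comp_of_setK n s : is_subset n s -> set_of_comp (comp_of_set n s) = s.
Proof.
case: n => [|n] h; first by case: s h => //= x s /andP[_ /=]; lia.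
have p := subset_path (ltn0Sn n) h.
rewrite /set_of_comp /comp_of_set size_pairmap size_rcons /=.
have E x t i : path ltn x t -> (i <= size t)%N ->
    sumn (take i (pairmap (fun x y => y - x)%N x t)) = (nth 0 (x :: t) i - x)%N.
  elim: t x i => [|y t IH] x [|i] //=; try lia.
  rewrite ltnS => /andP[xy q] it; rewrite IH //.
  suff : (y <= nth 0 (y :: t) i)%N by lia.
  move: q; rewrite path_sortedE; last exact: ltn_trans.
  case/andP=> /allP q _; case: i it => [|i] it //=.
  exact/ltnW/q/mem_nth.
apply: (@eq_from_nth _ 0%N); first by rewrite size_map size_iota.
move=> i; rewrite size_map size_iota => hi.
rewrite (nth_map 0%N) ?size_iota // nth_iota // E ?size_rcons //; last by lia.
by rewrite subn0 add1n /= nth_rcons hi.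
Qed.

Lemma set_of_compP n (a : composition n) : is_subset n (set_of_comp a).
Proof.
have E i j : (i < j <= size a -> sumn (take i a) < sumn (take j a))%N.
  move=> /andP[ij ja]; rewrite -(cat_take_drop i (take j a)) take_takel; last by lia.
  rewrite sumn_cat -[X in (X < _)%N]addn0 ltn_add2l.
  apply: leq_trans (size_le_sumn _); first by rewrite size_drop size_take; case: ifP; lia.
  apply/negP => /mem_drop /mem_take /parts_gt0; lia.
apply/andP; split; last first.
  apply/allP => _ /mapP[i + ->]; rewrite mem_iota => hi.
  have := E 0%N i; have := E i (size a); rewrite take_size take0 sum_parts /=; lia.
rewrite (sorted_map) ; apply: (@sub_in_sorted _ [pred i | (i < size a)%N] ltn).
- by move=> i j; rewrite !inE => hi hj ij; apply: E; lia.
- by apply/allP => i; rewrite mem_iota inE; lia.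
- exact: iota_ltn_sorted.
Qed.

Lemma set_of_compK n (a : composition n) : comp_of_set n (set_of_comp a) = a.
Proof.
case: n a => [|n] a.
  by case: a => [[|x s]] //= /andP[]; rewrite in_cons negb_or => /andP[x0 _] /=; lia.
have sa : (0 < size a)%N.
  by case: a => [[|x s]].
rewrite /set_of_comp /comp_of_set.
apply: (@eq_from_nth _ 0%N).
  by rewrite size_pairmap size_rcons size_map size_iota prednK.
move=> i; rewrite size_pairmap size_rcons size_map size_iota prednK // => hi.
have E k : (k <= size a)%N ->
    nth 0%N (0%N :: rcons [seq sumn (take i a) | i <- iota 1 (size a).-1] n.+1) k
    = sumn (take k a).
  case: k => [|k] hk; first by rewrite take0.
  rewrite /= nth_rcons size_map size_iota; case: ltnP => h.
    by rewrite (nth_map 0%N) ?size_iota // nth_iota.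
  by rewrite (_ : k == _); [rewrite (_ : k.+1 = size a) ?take_size ?sum_parts //|]; lia.
rewrite (nth_pairmap 0%N); last by rewrite size_rcons size_map size_iota prednK.
have := E i.+1 hi; rewrite /= => ->; rewrite E; last by lia.
by rewrite (take_nth 0%N) // sumn_rcons; lia.
Qed.

Definition compl_set (n : nat) (s : seq nat) : seq nat :=
  [seq i <- iota 1 n.-1 | i \notin s].

Lemma compl_setP n s : is_subset n (compl_set n s).
Proof.
apply/andP; split; first by apply/sorted_filter/iota_ltn_sorted/ltn_trans.
by apply/allP => i; rewrite mem_filter mem_iota => /andP[_]; lia.
Qed.

Definition compl_comp n (a : composition n) : composition n :=
  Composition (comp_of_setP (compl_setP n (set_of_comp a))).

Definition transpose_comp n (a : composition n) : composition n := rev_comp (compl_comp a).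

End ReverseComplement.

(* Formal power series in x_0, x_1, ... with integer coefficients, as an
   additive group: the series f has coefficient f m at the monomial m. *)
Definition power_series : Type := {cmonom nat} -> int.

HB.instance Definition _ := GRing.Zmodule.on power_series.

(* xmonom [:: i1; ..; il] [:: a1; ..; al] is x_i1 ^ a1 * .. * x_il ^ al. *)
Definition xmonom (i a : seq nat) : {cmonom nat} :=
  \big[mmul/onecm nat]_(p <- zip i a) expcmn (ucm p.1) p.2.

(* The sum over i1 < .. < il of x_i1 ^ a1 * .. * x_il ^ al: for positive
   exponents the indices are determined by the monomial, so that every
   coefficient is 0 or 1. *)
Definition monomialQ (a : seq nat) : power_series := fun m =>
  if `[< exists i, [/\ sorted ltn i, size i = size a & m = xmonom i a] >]
  then 1 else 0.

Definition refines (b a : seq nat) : bool :=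
  `[< exists2 bs : seq (seq nat), b = flatten bs & a = map sumn bs >].

Definition fundamentalQ n (a : composition n) : power_series :=
  \sum_(b : composition n | refines b a) monomialQ b.

Definition coefs : Type := forall n, composition n -> int.

Definition lincomb (X : forall n, composition n -> power_series) (N : nat)
    (c : coefs) : power_series :=
  \sum_(n < N) \sum_(a : composition n) X n a *~ c n a.

Definition span (X : forall n, composition n -> power_series)
    (f : power_series) : Prop :=
  exists e : nat * coefs, f = lincomb X e.1 e.2.

Definition QSym : power_series -> Prop := span (fun n a => monomialQ a).

(* The linear endomorphism of QSym mapping fundamentalQ a to fundamentalQ (s a):
   see linextF, linextD and linext_QSym.  Its value outside QSym is irrelevant. *)
Definition linext (s : forall n, composition n -> composition n)
    (f : power_series) : power_series :=
  if pselect (span fundamentalQ f) is left H then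
    let e := projT1 (cid H) in lincomb (fun n a => fundamentalQ (s n a)) e.1 e.2
  else 0.

Definition rho : power_series -> power_series := linext rev_comp.
Definition psi : power_series -> power_series := linext compl_comp.
Definition omega : power_series -> power_series := linext transpose_comp.

Section FundamentalBasis.

Lemma expcmnE (m : {cmonom nat}) k v : expcmn m k v = (k * m v)%N.
Proof.
case: k => [|k]; first by rewrite /expcmn onecmE.
rewrite /expcmn iteropS; elim: k => [|k IH] /=; first by rewrite mul1n.
by rewrite mulcmE IH [RHS]mulSn.
Qed.

Lemma xmonomE i a v : xmonom i a v = (\sum_(p <- zip i a) p.2 * (p.1 == v))%N.
Proof.
rewrite /xmonom; elim: (zip i a) => [|p s IH]; first by rewrite !big_nil onecmE.
by rewrite !big_cons cmM IH expcmnE ucmE.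
Qed.

Lemma xmonom_nth i a k : uniq i -> size i = size a -> (k < size i)%N ->
  xmonom i a (nth 0%N i k) = nth 0%N a k.
Proof.
rewrite xmonomE; elim: i a k => [|x i IH] [|y a] k //= /andP[xi ui] [sa].
rewrite big_cons /=; case: k => [|k] /= hk.
  rewrite eqxx muln1 big_seq big1 ?addn0 // => p /(map_f fst) /=.
  rewrite -/(unzip1 _) unzip1_zip ?sa // => pi.
  by rewrite (_ : _ == _ = false) ?muln0 //; apply: contraNF xi => /eqP <-.
by rewrite IH // (_ : _ == _ = false) ?muln0 //; apply: contraNF xi => /eqP ->; rewrite mem_nth.
Qed.

Lemma xmonom_out i a v : size i = size a -> v \notin i -> xmonom i a v = 0%N.
Proof.
move=> sa vi; rewrite xmonomE big_seq big1 // => p /(map_f fst).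
rewrite -/(unzip1 _) unzip1_zip ?sa // => pi.
by rewrite (_ : _ == _ = false) ?muln0 //; apply: contraNF vi => /eqP <-.
Qed.

Lemma xmonom_supp i a v : (0 \notin a)%N -> sorted ltn i -> size i = size a ->
  (v \in i) = (xmonom i a v != 0%N).
Proof.
move=> a0 si sa; case: (boolP (v \in i)) => vi; last by rewrite xmonom_out.
have hk : (index v i < size i)%N by rewrite index_mem.
rewrite -(nth_index 0%N vi) xmonom_nth ?(sorted_uniq ltn_trans ltnn) //.
by apply/esym; apply: contraNneq a0 => <-; rewrite mem_nth // -sa.
Qed.

Lemma xmonom_inj i j a b : (0 \notin a)%N -> (0 \notin b)%N ->
  sorted ltn i -> sorted ltn j -> size i = size a -> size j = size b ->
  xmonom i a = xmonom j b -> a = b.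
Proof.
move=> a0 b0 si sj sa sb E.
have ij : i = j.
  apply: (irr_sorted_eq ltn_trans ltnn si sj) => v.
  by rewrite (xmonom_supp _ a0) // (xmonom_supp _ b0) // E.
subst j; apply: (@eq_from_nth _ 0%N) => [|k]; first by rewrite -sa.
rewrite -sa => hk.
rewrite -(xmonom_nth _ sa) ?(sorted_uniq ltn_trans ltnn) //.
by rewrite E xmonom_nth ?(sorted_uniq ltn_trans ltnn).
Qed.

Definition stdm (a : seq nat) : {cmonom nat} := xmonom (iota 0 (size a)) a.

Lemma monomialQ_stdm n m (a : composition n) (b : composition m) :
  monomialQ b (stdm a) = (parts a == parts b)%:Z.
Proof.
have /andP[a0 _] := partsP a; have /andP[b0 _] := partsP b.
rewrite /monomialQ; case: asboolP => [[i [si sb E]]|h].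
  by rewrite (@xmonom_inj (iota 0 (size a)) i a b) ?eqxx ?size_iota ?iota_ltn_sorted.
case: eqVneq => // ab; case: h; exists (iota 0 (size a)).
by split; rewrite ?iota_ltn_sorted ?size_iota -?ab.
Qed.

Lemma refines_refl a : refines a a.
Proof.
apply/asboolP; exists [seq [:: x] | x <- a]; first by rewrite flatten_seq1.
by rewrite -map_comp -[LHS]map_id; apply: eq_map => x /=; rewrite addn0.
Qed.

Lemma refines_sumn b a : refines b a -> sumn b = sumn a.
Proof. by case/asboolP => bs -> ->; rewrite sumn_flatten. Qed.

Lemma refines_size b a : (0 \notin a)%N -> refines b a ->
  (size a <= size b)%N /\ (size a = size b -> b = a).
Proof.
move=> a0 /asboolP[bs -> ea]; move: a0; rewrite {}ea.
elim: bs => //= s bs IH; rewrite in_cons negb_or => /andP[s0 /IH[le eq]].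
have s1 : (0 < size s)%N by case: s s0.
rewrite size_cat size_map in le eq *; split; first by lia.
move=> h; rewrite eq; last by lia.
have : size s = 1%N by lia.
by case: s {h s1 s0} => [|x [|]] //=; rewrite addn0.
Qed.

Lemma fundamentalQ_stdm n m (a : composition n) (b : composition m) :
  fundamentalQ b (stdm a) = (refines a b)%:Z.
Proof.
rewrite /fundamentalQ fct_sumE (eq_bigr _ (fun c _ => monomialQ_stdm a c)).
case: (boolP (refines a b)) => r; last first.
  by rewrite big1 // => c cb; case: eqVneq => // e; rewrite e cb in r.
have am : is_composition m a.
  by have /andP[a0 _] := partsP a; rewrite /is_composition a0 (refines_sumn r) sum_parts eqxx.
rewrite (bigD1 (Composition am)) //= eqxx big1 ?addr0 // => c /andP[_ ca].
by case: eqVneq => // e; case/eqP: ca; apply: val_inj.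
Qed.

Definition trunc (N : nat) (c : coefs) : coefs :=
  fun n a => if (n < N)%N then c n a else 0.

Lemma mulrz_fct (f : power_series) (z : int) m : (f *~ z) m = f m *~ z.
Proof.
have nat k : (f *+ k) m = f m *+ k by rewrite natmulfctE.
by case: z => k; rewrite ?NegzE ?mulrNz ?pmulrn -?pmulrn //= ?opprfctE nat.
Qed.

Lemma lincomb_trunc X N N' c : (N <= N')%N ->
  lincomb X N c = \sum_(n < N') \sum_(a : composition n) X n a *~ trunc N c a.
Proof.
move=> NN'; rewrite /lincomb (big_ord_widen N' (fun n => \sum_(a : composition n) X n a *~ c n a)) //.
rewrite big_mkcond /=.
apply: eq_bigr => n _; rewrite /trunc; case: ifP => // _.
by rewrite big1.
Qed.

Lemma lincomb_ext X N N' c c' :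
  (forall n (a : composition n), trunc N c a = trunc N' c' a) ->
  lincomb X N c = lincomb X N' c'.
Proof.
move=> E; rewrite (lincomb_trunc _ _ (leq_maxl N N')).
rewrite (lincomb_trunc _ _ (leq_maxr N N')).
by apply: eq_bigr => n _; apply: eq_bigr => a _; rewrite E.
Qed.

Lemma lincombF_stdm N c n (a : composition n) :
  lincomb fundamentalQ N c (stdm a) = \sum_(b : composition n | refines a b) trunc N c b.
Proof.
rewrite (lincomb_trunc _ _ (leq_maxl N n.+1)) fct_sumE.
have nN : (n < maxn N n.+1)%N by rewrite leq_maxr.
rewrite (bigD1 (Ordinal nN)) //= [X in _ + X]big1 ?addr0; last first.
  move=> m mn; rewrite fct_sumE big1 // => b _; rewrite mulrz_fct fundamentalQ_stdm.
  case: (boolP (refines a b)) => [/refines_sumn|]; last by rewrite mul0rz.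
  by rewrite !sum_parts => nm; case/eqP: mn; apply: val_inj.
rewrite fct_sumE [RHS]big_mkcond; apply: eq_bigr => b _.
by rewrite mulrz_fct fundamentalQ_stdm; case: ifP; rewrite ?mul0rz ?intz.
Qed.

Lemma fundamentalQ_free N N' c c' : lincomb fundamentalQ N c = lincomb fundamentalQ N' c' ->
  forall n (a : composition n), trunc N c a = trunc N' c' a.
Proof.
move=> E n a; have [k] := ubnP (size a); elim: k a => // k IH a ak.
have := congr1 (fun f : power_series => f (stdm a)) E; rewrite !lincombF_stdm.
rewrite (bigD1 a) ?refines_refl //= [RHS](bigD1 a) ?refines_refl //=.
rewrite [X in _ + X](eq_bigr (fun b : composition n => trunc N' c' b)); first exact: addIr.
move=> b /andP[ab ba]; apply: IH.
have /andP[b0 _] := partsP b; have [le eq] := refines_size b0 ab.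
have ne : size b != size a.
  by apply: contraNneq ba => /eq e; apply/eqP/val_inj.
move: le; rewrite leq_eqVlt (negbTE ne) /= => lt; exact: leq_trans lt ak.
Qed.

Lemma linext_lincomb s N c :
  linext s (lincomb fundamentalQ N c) = lincomb (fun n a => fundamentalQ (s n a)) N c.
Proof.
rewrite /linext; case: pselect => [H|[]]; last by exists (N, c).
case: (cid H) => -[N' c'] /= E; apply: lincomb_ext => n a.
exact/esym/fundamentalQ_free.
Qed.

Lemma lincomb_delta (X : forall n, composition n -> power_series) n (a : composition n) :
  lincomb X n.+1 (fun m b => (parts b == parts a)%:Z) = X n a.
Proof.
rewrite /lincomb (bigD1 ord_max) //= (bigD1 a) //= eqxx.
rewrite !big1 ?addr0 // => [m mn|b /eqP ba].
  rewrite big1 // => b _; case: eqVneq => // ba; case/eqP: mn; apply: val_inj.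
  by have := congr1 sumn ba; rewrite !sum_parts.
by case: eqVneq => // e; case: ba; apply: val_inj.
Qed.

Lemma lincombD X N N' c c' : lincomb X N c + lincomb X N' c' =
  lincomb X (maxn N N') (fun n a => trunc N c a + trunc N' c' a).
Proof.
rewrite (lincomb_trunc _ _ (leq_maxl N N')) (lincomb_trunc _ _ (leq_maxr N N')).
rewrite -big_split; apply: eq_bigr => n _; rewrite -big_split.
by apply: eq_bigr => a _; apply/esym/mulrzDr.
Qed.

Lemma lincombN X N c : - lincomb X N c = lincomb X N (fun n a => - c n a).
Proof.
rewrite -sumrN; apply: eq_bigr => n _; rewrite -sumrN.
by apply: eq_bigr => a _; rewrite mulrNz.
Qed.

Lemma spanD X f g : span X f -> span X g -> span X (f + g).
Proof. by move=> [[N c] /= ->] [[N' c'] /= ->]; rewrite lincombD; eexists (_, _). Qed.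

Lemma spanN X f : span X f -> span X (- f).
Proof. by move=> [[N c] /= ->]; rewrite lincombN; eexists (_, _). Qed.

Lemma span0 X : span X 0.
Proof. by exists (0%N, fun n a => 0); rewrite /lincomb big_ord0. Qed.

Lemma span_sum X (I : Type) (r : seq I) (P : pred I) (f : I -> power_series) :
  (forall i, P i -> span X (f i)) -> span X (\sum_(i <- r | P i) f i).
Proof. by move=> H; apply: big_ind => //; [exact: span0 | exact: spanD]. Qed.

Lemma spanMz X f z : span X f -> span X (f *~ z).
Proof.
move=> H; have nat k : span X (f *+ k).
  by elim: k => [|k IH]; rewrite ?mulr0n ?mulrS; [exact: span0 | exact: spanD].
by case: z => k; rewrite ?NegzE ?mulrNz -pmulrn; [|apply: spanN]; apply: nat.
Qed.

Lemma span_gen X n (a : composition n) : span X (X n a).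
Proof. by rewrite -(lincomb_delta X a); eexists (_, _). Qed.

Lemma span_sub X Y f : (forall n (a : composition n), span Y (X n a)) ->
  span X f -> span Y f.
Proof.
by move=> H [[N c] /= ->]; apply: span_sum => n _; apply: span_sum => a _; apply: spanMz.
Qed.

Lemma spanF_monomialQ n (a : composition n) : span fundamentalQ (monomialQ a).
Proof.
have [k] := ubnP (n - size a); elim: k a => // k IH a ak.
have -> : monomialQ a = fundamentalQ a - \sum_(b : composition n | refines b a && (b != a)) monomialQ b.
  by rewrite /fundamentalQ [in RHS](bigD1 a) ?refines_refl //= addrK.
apply: spanD; first exact: span_gen.
apply/spanN/span_sum => b /andP[ba ne]; apply: IH.
have /andP[a0 _] := partsP a; have [le eq] := refines_size a0 ba.
have bn := size_parts_le b; have {}ne : size a != size b.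
  by apply: contraNneq ne => /eq e; apply/eqP/val_inj.
move: le; rewrite leq_eqVlt (negbTE ne) /= => lt.
by rewrite ltnS in ak; apply: leq_trans ak; apply: ltn_sub2l; first exact: leq_trans lt bn.
Qed.

Lemma QSymF f : QSym f <-> span fundamentalQ f.
Proof.
split; apply: span_sub => n a; first exact: spanF_monomialQ.
by apply: span_sum => b _; apply: (span_gen (fun n a => monomialQ a)).
Qed.

Lemma linextF s n (a : composition n) : linext s (fundamentalQ a) = fundamentalQ (s n a).
Proof. by rewrite -(lincomb_delta fundamentalQ a) linext_lincomb lincomb_delta. Qed.

Lemma linextD s f g : QSym f -> QSym g ->
  linext s (f + g) = linext s f + linext s g.
Proof.
move=> /QSymF[[N c] /= ->] /QSymF[[N' c'] /= ->].
by rewrite lincombD !linext_lincomb lincombD.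
Qed.

Lemma linext_QSym s f : QSym f -> QSym (linext s f).
Proof.
move=> /QSymF[[N c] /= ->]; apply/QSymF; rewrite linext_lincomb.
by apply: span_sum => n _; apply: span_sum => a _; apply/spanMz/span_gen.
Qed.

End FundamentalBasis.

(* Rows are numbered from bottom to top: row 0 is the bottom row. *)
Definition cell (a : seq nat) : finType := {i : 'I_(size a) & 'I_(nth 0%N a i)}.

Definition row_of (a : seq nat) (x : cell a) : nat := tag x.
Definition col_of (a : seq nat) (x : cell a) : nat := tagged x.

(* The content b forces the entries to lie in [1, size b]; the value k of
   'I_(size b) stands for the entry k + 1. *)
Definition immaculate (a b : seq nat) (T : {ffun cell a -> 'I_(size b)}) : bool :=
  [&& [forall x, forall y,
        [&& col_of x == 0, col_of y == 0 & row_of x < row_of y] ==> (T x < T y)],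
      [forall x, forall y,
        (row_of x == row_of y) && (col_of x <= col_of y) ==> (T x <= T y)]
    & [forall k : 'I_(size b), #|[set x | T x == k]| == nth 0 b k]]%N.

Definition immaculate_kostka (a b : seq nat) : nat :=
  #|[set T : {ffun cell a -> 'I_(size b)} | immaculate T]|.

Definition dual_immaculate n (a : composition n) : power_series :=
  \sum_(b : composition n) monomialQ b *+ immaculate_kostka a b.

(* The dual immaculate functions of degree n are a basis of the degree n part of
   QSym, so the coefficients c are determined by f. *)
Definition one_term n (f : power_series) : Prop :=
  exists2 c : composition n -> int,
    f = \sum_(b : composition n) dual_immaculate b *~ c b
  & exists! b, c b != 0.

Definition bottom_hook n (a : composition n) : Prop :=
  parts a = nseq n 1%N \/
  exists k l, (2 <= k)%N /\ parts a = k :: nseq l 1%N.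

Definition top_hook n (a : composition n) : Prop :=
  parts a = nseq n 1%N \/
  exists k l, (2 <= k)%N /\ parts a = rcons (nseq l 1%N) k.

(* Main.v *)
Require Import Defs.
From mathcomp Require Import all_boot all_order all_algebra zify.
From mathcomp Require Import boolp.

Set Implicit Arguments.
Unset Strict Implicit.
Unset Printing Implicit Defensive.

Import GRing.Theory.

(** The proof expands everything in the fundamental basis.

    Recording the row of each entry turns a standard immaculate tableau of shape
    [a] into a word with [a_i] letters [i], in which the first occurrences of the
    letters come in increasing order.  Standardization of semi-standard tableaux
    ([immaculate_kostkaE]) then shows that a dual immaculate function is the sum of
    the fundamental functions of the descent compositions of these words
    ([dual_immaculateE]).  As the three maps permute the fundamental functions, and
    as all coefficients are nonnegative, a one-term image forces an equality
    between the set of descent compositions of [b] and the image of that of [a]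
    ([one_term_supp]).

    The set of descent compositions of a shape [a] of length [l] sees enough of
    [a]: all of them have length at least [l]; a tableau without descents below
    [m] needs [m] cells in the first row; a run of [r] descents needs more than [r]
    rows; the set [1, l - 1] occurs; and if two rows have more than one cell, then
    a composition longer than [a] occurs.  Applying the reversal, the complement or
    the transpose to the set [1, l' - 1] that belongs to [b] yields inequalities
    between the length and the first part of [a] that leave only hooks
    ([rho_supp_bottom], [psi_supp_bottom], [omega_supp_hook]).

    Conversely, the descent compositions of a bottom-aligned hook of length [l] are
    all compositions of length [l], each once ([perm_bottom_descent_comps]), and
    this family is reversed into itself and complemented into the one of length
    [n + 1 - l].  A top-aligned hook has only one standard tableau
    ([top_comp_words]), so its function is a single fundamental function, and its
    transpose is again a top-aligned hook. *)

(** * Words of standard immaculate tableaux *)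

Fixpoint row_word_from (c : nat) (a : seq nat) : seq nat :=
  if a is x :: a' then nseq x c ++ row_word_from c.+1 a' else [::].

(** Besides being the reading word of the tableau whose rows are filled one
    after the other, [row_word b] is the sorted list of the entries of any
    tableau of content [b]; it thus gives the index of the block of [b] that
    contains a position. *)
Definition row_word (a : seq nat) : seq nat := row_word_from 0 a.

Definition first_occ (l : nat) (w : seq nat) : bool :=
  all (fun i => index i w < index i.+1 w) (iota 0 l.-1).

(** A standard immaculate tableau of shape [a] is encoded by the word whose
    letter at position [p] is the row of the entry [p + 1].  The number of letters
    [i] is the length of row [i]; the first column increases exactly when the
    first occurrences of the letters come in increasing order. *)
Definition immaculate_words (a : seq nat) : seq (seq nat) :=
  [seq w <- permutations (row_word a) | first_occ (size a) w].

(** The position [p] counts from 0, so that a descent at [p] compares the rows of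
    the entries [p] and [p + 1]: this is a descent of the tableau, and with this
    indexing [descents] is comparable with [set_of_comp]. *)
Definition descents (w : seq nat) : seq nat :=
  [seq p <- iota 1 (size w).-1 | nth 0 w p.-1 < nth 0 w p].

Lemma count_row_word_from c (a : seq nat) i :
  count_mem i (row_word_from c a) = if c <= i then nth 0 a (i - c) else 0.
Proof.
elim: a c => [|x a IH] c /=; first by rewrite nth_nil if_same.
rewrite count_cat count_nseq IH /= eq_sym.
case: (ltngtP c i) => ci; rewrite ?mul0n ?mul1n //=.
  by rewrite -(subnSK ci).
by rewrite ci subnn addn0.
Qed.

Lemma count_row_word a i : count_mem i (row_word a) = nth 0 a i.
Proof. by rewrite count_row_word_from subn0. Qed.

Lemma size_row_word_from c a : size (row_word_from c a) = sumn a.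
Proof. by elim: a c => //= x a IH c; rewrite size_cat size_nseq IH. Qed.

Lemma size_row_word a : size (row_word a) = sumn a.
Proof. exact: size_row_word_from. Qed.

Lemma perm_row_wordP w a :
  reflect (forall i, count_mem i w = nth 0 a i) (perm_eq w (row_word a)).
Proof.
apply: (iffP idP) => [/permP e i|e]; first by rewrite e count_row_word.
by apply/allP => i _; rewrite /= e count_row_word.
Qed.

Lemma row_word_from_ge c a x : x \in row_word_from c a -> c <= x.
Proof.
elim: a c => //= y a IH c; rewrite mem_cat mem_nseq => /orP[/andP[_ /eqP->]//|/IH].
exact: ltnW.
Qed.

Lemma sorted_row_word_from c a : sorted leq (row_word_from c a).
Proof.
elim: a c => //= x a IH c; rewrite sorted_pairwise; last exact: leq_trans.
rewrite pairwise_cat -!sorted_pairwise ?IH; try exact: leq_trans.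
rewrite andbT; apply/andP; split.
  by apply/allrelP => y z /nseqP[-> _] /row_word_from_ge /ltnW.
rewrite sorted_pairwise; last exact: leq_trans.
by elim: x => //= x ->; rewrite andbT; apply/allP => y /nseqP[-> _].
Qed.

Lemma sorted_row_word a : sorted leq (row_word a).
Proof. exact: sorted_row_word_from. Qed.

Lemma mem_immaculate_words a w :
  w \in immaculate_words a =
  perm_eq w (row_word a) && first_occ (size a) w.
Proof. by rewrite mem_filter mem_permutations andbC. Qed.

Lemma uniq_immaculate_words a : uniq (immaculate_words a).
Proof. exact/filter_uniq/permutations_uniq. Qed.

Lemma mem_descents w p :
  (p \in descents w) = (0 < p < size w) && (nth 0 w p.-1 < nth 0 w p).
Proof. by rewrite mem_filter mem_iota andbC; congr (_ && _); lia. Qed.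

Lemma descentsP n w : size w = n -> is_subset n (descents w).
Proof.
move=> <-; apply/andP; split; first exact/sorted_filter/iota_ltn_sorted/ltn_trans.
by apply/allP => p; rewrite mem_descents => /andP[].
Qed.

Lemma mem_set_of_comp s p :
  (p \in set_of_comp s) <-> exists2 i, 0 < i < size s & p = sumn (take i s).
Proof.
rewrite /set_of_comp; split=> [/mapP[i] | [i i0 ->]].
  by rewrite mem_iota => hi ->; exists i => //; lia.
by apply/mapP; exists i; rewrite // mem_iota; lia.
Qed.

Lemma set_of_comp_cons x y s p : 
  (p \in set_of_comp [:: x, y & s]) =
  (p == x) || ((x <= p) && (p - x \in set_of_comp (y :: s))).
Proof.
apply/idP/idP => [/mem_set_of_comp[[|[|i]] //= i0 ->] |
  /orP[/eqP->|/andP[px /mem_set_of_comp[i i0 e]]]].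
- by rewrite addn0 eqxx.
- rewrite leq_addr addKn; apply/orP; right.
  by apply/mem_set_of_comp; exists i.+1.
- by apply/mem_set_of_comp; exists 1 => //=; rewrite addn0.
- apply/mem_set_of_comp; exists i.+1; first by move: i0 => /=; lia.
  by rewrite [take _ _]/= [sumn _]/= -e; lia.
Qed.

(** A row word stays constant inside a row and increases when a new row starts,
    which happens at the partial sums of the row lengths. *)
Lemma row_word_from_jump c (a : seq nat) p : 0 \notin a -> 0 < p < sumn a ->
  (nth 0 (row_word_from c a) p.-1 < nth 0 (row_word_from c a) p)
  = (p \in set_of_comp a).
Proof.
elim: a c p => [|x a IH] c p; first by rewrite ltn0 andbF.
rewrite in_cons negb_or => /andP[x0 a0] /andP[p0 pa] /=.
rewrite !nth_cat !nth_nseq size_nseq.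
case: a IH a0 pa => [|y a] IH a0 pa.
  have -> : p.-1 < x by move: pa => /=; lia.
  have -> : p < x by move: pa => /=; lia.
  by rewrite ltnn.
rewrite set_of_comp_cons.
case: (ltngtP p x) => px.
- by rewrite (_ : p.-1 < x) ?ltnn; lia.
- rewrite (_ : p.-1 < x = false); last by lia.
  by rewrite (_ : p.-1 - x = (p - x).-1) ?IH //=; move: pa => /=; lia.
- rewrite (_ : p.-1 < x); last by lia.
  rewrite px subnn; by case: y a0 pa {IH} => //= y _ _; rewrite ltnSn.
Qed.

Lemma descents_row_word n (a : composition n) : descents (row_word a) =i set_of_comp a.
Proof.
have /andP[a0 _] := partsP a; have /andP[_ /allP sa] := set_of_compP a.
move=> p; rewrite mem_descents size_row_word sum_parts.
apply/idP/idP => [/andP[hp]|pa]; first by rewrite row_word_from_jump // sum_parts.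
by rewrite (sa _ pa) /row_word row_word_from_jump // sum_parts (sa _ pa).
Qed.

(** * Descents of the words of a given shape *)

Lemma first_occ_lt l w i j : first_occ l w -> i < j < l -> index i w < index j w.
Proof.
move=> /allP h /andP[ij jl].
have {}h k : k.+1 < l -> index k w < index k.+1 w.
  by move=> kl; apply: h; rewrite mem_iota; lia.
elim: j ij jl => // j IH; rewrite ltnS leq_eqVlt => /orP[/eqP->|ij] jl; first exact: h.
by apply: ltn_trans (h j jl); apply: IH => //; lia.
Qed.

Section ImmaculateWord.

Variables (a w : seq nat).
Hypotheses (a_pos : 0 \notin a) (aw : w \in immaculate_words a).

Lemma immaculate_perm : perm_eq w (row_word a).
Proof. by move: aw; rewrite mem_immaculate_words => /andP[]. Qed.

Lemma immaculate_count i : count_mem i w = nth 0 a i.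
Proof. exact/perm_row_wordP/immaculate_perm. Qed.

Lemma immaculate_size : size w = sumn a.
Proof. by rewrite (perm_size immaculate_perm) size_row_word. Qed.

Lemma immaculate_mem i : (i \in w) = (i < size a).
Proof.
rewrite -has_pred1 has_count immaculate_count.
case: (ltnP i (size a)) => h; last by rewrite nth_default.
by rewrite lt0n; apply: contraNneq a_pos => <-; rewrite mem_nth.
Qed.

Lemma immaculate_nth p : p < size w -> nth 0 w p < size a.
Proof. by move=> pw; rewrite -immaculate_mem mem_nth. Qed.

Lemma immaculate_index i j : i < j < size a -> index i w < index j w.
Proof.
by apply: first_occ_lt; move: aw; rewrite mem_immaculate_words => /andP[].
Qed.

Lemma immaculate_index_le i j : i < size a -> j < size a ->
  index i w <= index j w -> i <= j.
Proof.
move=> il jl; apply: contraTT; rewrite -!ltnNge => ji.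
by apply: immaculate_index; rewrite ji.
Qed.

Lemma immaculate_nth0 : 0 < size w -> nth 0 w 0 = 0.
Proof.
move=> w0; have h := immaculate_nth w0.
have := @immaculate_index_le _ 0 h (leq_ltn_trans (leq0n _) h).
rewrite [X in X <= _](_ : _ = 0); first by move=> /(_ isT); lia.
by case: (w) w0 => //= x s _; rewrite eqxx.
Qed.

(** The letter before the first occurrence of [i] cannot be [i], and cannot be
    larger since the first occurrences of larger letters come later. *)
Lemma index_mem_descents i : 0 < i < size a -> index i w \in descents w.
Proof.
move=> /andP[i0 il]; have iw : i \in w by rewrite immaculate_mem.
have pw : index i w < size w by rewrite index_mem.
have p0 : 0 < index i w.
  by apply: leq_ltn_trans (@immaculate_index i.-1 i _); lia.
rewrite mem_descents p0 pw (nth_index _ iw) /= ltnNge; apply/negP => h.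
have jw : (index i w).-1 < size w by lia.
have := index_nth 0 jw.
have := immaculate_nth jw; move: h; set j := nth _ _ _.
rewrite leq_eqVlt => /orP[/eqP <-|ij jl]; first by lia.
by have := @immaculate_index i j; rewrite ij jl => /(_ isT); lia.
Qed.

Lemma size_descents_ge : (size a).-1 <= size (descents w).
Proof.
have := @uniq_leq_size _ [seq index i w | i <- iota 1 (size a).-1] (descents w).
rewrite size_map size_iota; apply.
  rewrite map_inj_in_uniq ?iota_uniq // => i j; rewrite !mem_iota => hi hj e.
  have [il jl] : i < size a /\ j < size a by lia.
  by apply/eqP; rewrite eqn_leq; apply/andP; split; apply: immaculate_index_le; rewrite ?e.
move=> _ /mapP[i hi ->].
have hi' : 0 < i < size a by move: hi; rewrite mem_iota; lia.
exact: index_mem_descents.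
Qed.

(** The word starts with 0, so an initial stretch without descents consists of
    zeros only. *)
Lemma no_descent_le m : m <= size w ->
  (forall p, 0 < p < m -> p \notin descents w) -> m <= head 0 a.
Proof.
move=> mw h.
have z p : p < m -> nth 0 w p = 0.
  elim: p => [|p IH] pm; first by rewrite immaculate_nth0; lia.
  have := h p.+1; rewrite mem_descents /= IH; last by lia.
  by rewrite pm => /(_ isT); have -> : p.+1 < size w; lia.
rewrite -nth0 -immaculate_count -(cat_take_drop m w) count_cat.
rewrite (_ : take m w = nseq m 0); first by rewrite count_nseq mul1n leq_addr.
apply: (@eq_from_nth _ 0) => [|p]; rewrite size_takel // ?size_nseq // => pm.
by rewrite nth_take // z // nth_nseq pm.
Qed.

(** Along [r] consecutive descents the letters strictly increase, so that the
    last one is at least [r]. *)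
Lemma descent_run q r : 0 < q -> q + r <= size w ->
  (forall p, q <= p < q + r -> p \in descents w) -> (0 < size w) -> r < size a.
Proof.
move=> q0 qr h w0; have k s : s <= r -> s <= nth 0 w (q.-1 + s).
  elim: s => // s IH sr; have := h (q + s); rewrite mem_descents.
  rewrite (_ : q.-1 + s.+1 = q + s); last by lia.
  rewrite (_ : (q + s).-1 = q.-1 + s); last by lia.
  by move=> /(_ ltac:(lia)) /andP[_]; have := IH ltac:(lia); lia.
apply: leq_ltn_trans (k r (leqnn r)) _; apply: immaculate_nth; lia.
Qed.

End ImmaculateWord.

Lemma immaculate_iota_cat (a v : seq nat) : perm_eq (iota 0 (size a) ++ v) (row_word a) ->
  iota 0 (size a) ++ v \in immaculate_words a.
Proof.
move=> pv; rewrite mem_immaculate_words pv; apply/allP => i; rewrite mem_iota => hi.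
have e k : k < size a -> index k (iota 0 (size a) ++ v) = k.
  move=> kl; rewrite index_cat mem_iota /= kl.
  have := @index_uniq _ 0 k (iota 0 (size a)); rewrite size_iota nth_iota //.
  by apply; rewrite ?iota_uniq.
by rewrite !e; lia.
Qed.

(** The letters of a word of shape [a] are one letter for each row, which will
    serve as the first column, together with the letters for the shortened rows. *)
Lemma perm_iota_pred (a : seq nat) : 0 \notin a ->
  perm_eq (iota 0 (size a) ++ row_word (map predn a)) (row_word a).
Proof.
move=> a0; apply/perm_row_wordP => i; rewrite count_cat count_row_word.
rewrite count_uniq_mem ?iota_uniq // mem_iota /=.
case: (ltnP i (size a)) => h; last by rewrite !nth_default ?size_map.
rewrite (nth_map 0) //; have : nth 0 a i != 0 by apply: contraNneq a0 => <-; rewrite mem_nth.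
lia.
Qed.

Lemma row_word_immaculate (a : seq nat) : 0 \notin a -> row_word a \in immaculate_words a.
Proof.
move=> a0; rewrite mem_immaculate_words perm_refl; apply/allP => i; rewrite mem_iota => hi.
have im k : k < size a -> k \in row_word a.
  move=> ka; rewrite -has_pred1 has_count count_row_word lt0n.
  by apply: contraNneq a0 => <-; rewrite mem_nth.
have ia : i \in row_word a by apply: im; lia.
have ja : i.+1 \in row_word a by apply: im; lia.
rewrite ltnNge; apply/negP => h.
have := sorted_leq_nth leq_trans leqnn 0 (sorted_row_word a).
move=> /(_ (index i.+1 (row_word a)) (index i (row_word a))).
rewrite !inE !index_mem => /(_ ja ia h).
by rewrite !nth_index // ltnn.
Qed.

(** Put the first column first, and then all other cells in weakly decreasing
    order of rows: only the first column creates descents. *)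
Lemma exists_initial_descents (a : seq nat) : 0 \notin a ->
  exists2 w, w \in immaculate_words a & forall p : nat, (p \in descents w) = (0 < p < size a).
Proof.
move=> a0; set v := rev (row_word (map predn a)); exists (iota 0 (size a) ++ v).
  by apply/immaculate_iota_cat/(perm_trans _ (perm_iota_pred a0)); rewrite perm_cat2l perm_rev.
have vs : sorted geq v by rewrite /v rev_sorted sorted_row_word.
have va (x : nat) : x \in v -> x < size a.
  rewrite mem_rev -has_pred1 has_count count_row_word lt0n => h.
  by rewrite ltnNge; apply: contraNN h => h; rewrite nth_default // size_map.
clearbody v => p; rewrite mem_descents size_cat size_iota !nth_cat size_iota.
case: (posnP p) => //= p0; have -> : p.-1 < size a = (p <= size a) by lia.
case: (ltngtP p (size a)) => pa.
- by rewrite !nth_iota; lia.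
- apply/negbTE/negP => /andP[h]; apply/negP; rewrite -leqNgt.
  apply: (sorted_leq_nth _ _ 0 vs); rewrite ?inE; try lia.
  + by move=> x y z; rewrite /geq /=; lia.
  + by move=> x; rewrite /geq /=.
- apply/negbTE/negP => /andP[h]; apply/negP; rewrite -leqNgt pa subnn nth_iota; last by lia.
  have v0 : 0 < size v by lia.
  have := va (nth 0 v 0) (mem_nth 0 v0); lia.
Qed.

(** When two rows [j < i] have second cells, fill the first column and then these
    two cells in the order [j], [i]: this creates a descent besides those of the
    first column. *)
Lemma exists_extra_descent (a : seq nat) i j : 0 \notin a -> j < i < size a ->
  1 < nth 0 a i -> 1 < nth 0 a j ->
  exists2 w, w \in immaculate_words a & size a <= size (descents w).
Proof.
move=> a0 /andP[ji il] ai aj; set v := row_word (map predn a).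
have vm k : (k < size a) -> 1 < nth 0 a k -> k \in v.
  by move=> kl ak; rewrite -has_pred1 has_count count_row_word (nth_map 0) //; lia.
have iv : i \in v by apply: vm.
have jv : j \in rem i v.
  rewrite -has_pred1 has_count count_rem /= iv (gtn_eqF ji) subn0 -has_count has_pred1.
  by apply: vm => //; lia.
exists (iota 0 (size a) ++ [:: j, i & rem j (rem i v)]).
  apply/immaculate_iota_cat/(perm_trans _ (perm_iota_pred a0)); rewrite perm_cat2l -/v.
  rewrite -(cat1s j) -(cat1s i) perm_sym; apply: perm_trans (perm_to_rem iv) _.
  rewrite perm_sym perm_catCA /= perm_cons perm_sym; exact: perm_to_rem.
set w := _ ++ _.
have := @uniq_leq_size _ ((size a).+1 :: iota 1 (size a).-1) (descents w).
rewrite /= size_iota mem_iota iota_uniq prednK; last by lia.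
apply; first by lia.
move=> p; rewrite in_cons mem_iota mem_descents size_cat size_iota /= !nth_cat size_iota.
case/orP=> [/eqP->|hp].
  by rewrite /= ltnn subnn (_ : (size a).+1 < size a = false) ?subSnn /= ?ji; lia.
have [h1 h2] : p.-1 < size a /\ p < size a by lia.
rewrite h1 h2 !nth_iota //; lia.
Qed.

(** * Standardization *)

(** Pairs (entry, row) are read by increasing entries, and from top to bottom
    among equal entries: this is the order of standardization, in which equal
    entries create no descent. *)
Definition biword_le (x y : nat * nat) : bool :=
  (x.1 < y.1) || ((x.1 == y.1) && (y.2 <= x.2)).

Lemma biword_le_refl : reflexive biword_le.
Proof. by move=> x; rewrite /biword_le eqxx leqnn orbT. Qed.

Lemma biword_le_trans : transitive biword_le.
Proof. by move=> [a b] [c d] [e f]; rewrite /biword_le /=; lia. Qed.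

Lemma biword_le_total : total biword_le.
Proof. by move=> [a b] [c d]; rewrite /biword_le /=; lia. Qed.

Lemma biword_le_anti : antisymmetric biword_le.
Proof.
move=> [a b] [c d]; rewrite /biword_le /= => h.
by have [-> ->] : a = c /\ b = d by lia.
Qed.

Lemma sorted_biword_fst s : sorted biword_le s -> sorted leq (unzip1 s).
Proof.
rewrite sorted_map; apply: sub_sorted => -[a b] [c d]; rewrite /biword_le /=; lia.
Qed.

Lemma head_row (r w : seq nat) i : size r = size w -> i \in w ->
  nth 0 [seq q.1 | q <- zip r w & q.2 == i] 0 = nth 0 r (index i w).
Proof.
elim: r w => [|x r IH] [|y w] //= [sw]; rewrite in_cons eq_sym.
by case: eqVneq => //= _ iw; apply: IH.
Qed.

Section Kostka.

Variables (n : nat) (a b : composition n).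

Notation tableau := {ffun cell a -> 'I_(size b)}.

Definition box (i : 'I_(size a)) (j : 'I_(nth 0 a i)) : cell a :=
  Tagged (fun i : 'I_(size a) => 'I_(nth 0 a i)) j.

Definition pairs (T : tableau) : seq (nat * nat) :=
  [seq (T x : nat, row_of x) | x <- enum {: cell a}].

Definition reading_word (T : tableau) : seq nat :=
  unzip2 (sort biword_le (pairs T)).

Definition row_entries (T : tableau) (i : 'I_(size a)) : seq nat :=
  [seq (T (box j) : nat) | j <- enum 'I_(nth 0 a i)].

Lemma count_pairs T (P : pred (nat * nat)) :
  count P (pairs T) =
  \sum_(i < size a) \sum_(j < nth 0 a i) P (T (box j) : nat, i : nat).
Proof.
rewrite (sig_big_dep _ _ (fun (i : 'I_(size a)) (j : 'I_(nth 0 a i)) =>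
  P (T (box j) : nat, i : nat) : nat)) /=.
rewrite count_map -sum1_count big_mkcond big_enum /=; apply: eq_bigr => -[i j] _ /=.
by rewrite /row_of /=; case: (P _).
Qed.

Lemma count_row_entries T i k :
  count_mem k (row_entries T i) = count_mem (k, i : nat) (pairs T).
Proof.
rewrite count_pairs (bigD1 i) //= [X in _ + X]big1 ?addn0 => [|j ji].
  rewrite count_map -sum1_count big_mkcond big_enum /=; apply: eq_bigr => j _.
  by rewrite /= xpair_eqE eqxx andbT; case: eqP.
apply: big1 => k' _; rewrite xpair_eqE andbC (_ : (j : nat) == i = false) //.
exact/negbTE.
Qed.

Lemma size_row_entries T i : size (row_entries T i) = nth 0 a i.
Proof. by rewrite size_map -cardE card_ord. Qed.

Lemma nth_row_entries T (i : 'I_(size a)) (j : 'I_(nth 0 a i)) :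
  nth 0 (row_entries T i) j = T (box j).
Proof. by rewrite (nth_map j) ?size_enum_ord // nth_ord_enum. Qed.

Lemma count_pairs_fst T k : count_mem k (unzip1 (pairs T)) = #|[set x | T x == k :> nat]|.
Proof.
by rewrite cardsE cardE /enum_mem size_filter /pairs enumT !count_map; apply: eq_count.
Qed.

(** In a row it suffices to compare neighbours, and the content is the multiset of
    the first components of [pairs T]. *)
Lemma immaculateP (T : tableau) : immaculate T <->
  [/\ forall x y, col_of x = 0 -> col_of y = 0 -> row_of x < row_of y -> T x < T y,
      forall i, sorted leq (row_entries T i)
    & perm_eq (unzip1 (pairs T)) (row_word b)].
Proof.
rewrite /immaculate; split.
  case/and3P => /forallP h1 /forallP h2 /forallP h3; split.
  - move=> x y cx cy rxy; have /forallP/(_ y) := h1 x.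
    by rewrite cx cy rxy.
  - move=> i; apply/(sortedP 0) => j; rewrite size_row_entries => ji.
    have j0 : j < nth 0 a i by apply: ltn_trans ji.
    have := h2 (box (Ordinal j0)).
    move=> /forallP /(_ (box (Ordinal ji))).
    rewrite /row_of /col_of /= eqxx leqnSn /=.
    by rewrite -!(nth_row_entries T).
  - apply/perm_row_wordP => k; rewrite count_pairs_fst.
    case: (ltnP k (size b)) => kb; first by rewrite -(eqP (h3 (Ordinal kb))).
    rewrite nth_default //; apply/eqP; rewrite cards_eq0; apply/eqP/setP => x.
    by rewrite !inE; apply/negbTE; have := ltn_ord (T x); lia.
case=> h1 h2 h3; apply/and3P; split.
- apply/forallP => x; apply/forallP => y; apply/implyP => /and3P[/eqP cx /eqP cy].
  exact: h1.
- apply/forallP => -[i j]; apply/forallP => -[i' j']; apply/implyP.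
  rewrite /row_of /col_of /= => /andP[/eqP/val_inj e]; subst i' => jj.
  rewrite -!nth_row_entries; apply: (sorted_leq_nth leq_trans leqnn 0 (h2 i)) => //.
    by rewrite inE size_row_entries.
  by rewrite inE size_row_entries.
- apply/forallP => k; apply/eqP; move/perm_row_wordP: h3 => /(_ k) <-.
  by rewrite count_pairs_fst.
Qed.

Lemma sort_pairs_fst (T : tableau) : immaculate T ->
  unzip1 (sort biword_le (pairs T)) = row_word b.
Proof.
case/immaculateP => _ _ h; apply: (sorted_eq leq_trans anti_leq).
- exact/sorted_biword_fst/sort_sorted/biword_le_total.
- exact: sorted_row_word.
- by apply: perm_trans h; apply: perm_map; rewrite perm_sort.
Qed.

(** The sorted list of pairs is recovered from its second components, as its
    first components form [row_word b].  It determines the multiset of entries of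
    each row, and the rows are sorted. *)
Lemma reading_word_inj : {in [pred T : tableau | immaculate T] &, injective reading_word}.
Proof.
move=> T T'; rewrite !inE => hT hT' e.
have E : perm_eq (pairs T) (pairs T').
  rewrite -(perm_sort biword_le) -(permPr (permEl (perm_sort biword_le _))).
  rewrite -[sort _ (pairs T)]zip_unzip -[sort _ (pairs T')]zip_unzip !sort_pairs_fst //.
  by rewrite -/(reading_word T) -/(reading_word T') e.
have R i : row_entries T i = row_entries T' i.
  have /immaculateP[_ sT _] := hT; have /immaculateP[_ sT' _] := hT'.
  apply: (sorted_eq leq_trans anti_leq (sT i) (sT' i)).
  by apply/allP => k _; rewrite /= !count_row_entries; apply/eqP/permP.
apply/ffunP => -[i j]; apply: val_inj.
by rewrite /= -(nth_row_entries T) -(nth_row_entries T') R.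
Qed.

Lemma count_reading_word (T : tableau) i : count_mem i (reading_word T) = nth 0 a i.
Proof.
rewrite /reading_word count_map (permP (permEl (perm_sort _ _))) count_pairs.
case: (ltnP i (size a)) => ia; last first.
  rewrite nth_default // big1 // => j _; rewrite big1 // => k _ /=.
  by rewrite (_ : (j : nat) == i = false) //; have := ltn_ord j; lia.
rewrite (bigD1 (Ordinal ia)) //= eqxx sum_nat_const card_ord muln1.
rewrite big1 ?addn0 // => j ji; rewrite big1 // => k _ /=.
by rewrite (_ : (j : nat) == i = false) //; apply/negbTE.
Qed.

(** A descent of the reading word needs a strict increase of the entries, that is
    the end of a block of [b].  As to first occurrences, any cell of row [i + 1]
    has an entry at least that of its leftmost cell, which exceeds the leftmost
    entry of row [i]. *)
Lemma reading_word_mem (T : tableau) : immaculate T ->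
  reading_word T \in [seq w <- immaculate_words a | all (mem (set_of_comp b)) (descents w)].
Proof.
move=> hT; have /immaculateP[h1 h2 h3] := hT.
set s := sort biword_le (pairs T); set w := reading_word T.
have ss : sorted biword_le s by apply/sort_sorted/biword_le_total.
have sle p q : p <= q < size s -> biword_le (nth (0, 0) s p) (nth (0, 0) s q).
  move=> /andP[pq qs]; apply: (sorted_leq_nth biword_le_trans _ (0, 0) ss) => //.
    by move=> x; rewrite /biword_le eqxx leqnn orbT.
  exact: leq_ltn_trans pq qs.
have sw : size w = size s by rewrite size_map.
have nw p : p < size s -> nth 0 w p = (nth (0, 0) s p).2.
  by move=> ps; rewrite (nth_map (0, 0)).
rewrite mem_filter mem_immaculate_words; apply/and3P; split.
- apply/allP => p; rewrite mem_descents sw => /andP[/andP[p0 ps]].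
  rewrite !nw; try lia; move=> hd.
  rewrite inE /= -descents_row_word mem_descents -(sort_pairs_fst hT) size_map p0 ps /=.
  have ps' : p.-1 < size s by apply: leq_ltn_trans (leq_pred p) ps.
  rewrite !(nth_map (0, 0)) //.
  by have := sle p.-1 p; rewrite /biword_le -/s; lia.
- by apply/perm_row_wordP => i; exact: count_reading_word.
- apply/allP => i; rewrite mem_iota => hi.
  have pos k : k < size a -> 0 < nth 0 a k.
    by move=> ka; apply: (@parts_gt0 _ a); rewrite mem_nth.
  have il : i < size a by lia.
  have jl : i.+1 < size a by lia.
  have mw k : k < size a -> k \in w.
    by move=> ka; rewrite -has_pred1 has_count count_reading_word pos.
  set x : cell a := @box (Ordinal il) (Ordinal (pos _ il)).
  have xs : (T x : nat, i) \in s by rewrite mem_sort; apply/mapP; exists x; rewrite ?mem_enum.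
  set q := index (T x : nat, i) s.
  have qs : q < size s by rewrite index_mem.
  have iq : index i w <= q.
    have := @index_nth _ 0 q w; rewrite sw nw // nth_index // => /(_ qs) //.
  apply: (leq_ltn_trans iq); rewrite ltnNge; apply/negP => pq.
  set p := index i.+1 w in pq *.
  have ps : p < size s by rewrite -sw index_mem mw.
  have wp : nth 0 w p = i.+1 by rewrite nth_index ?mw.
  have : nth (0, 0) s p \in pairs T by rewrite -(mem_sort biword_le) mem_nth.
  case/mapP => -[i' j'] _ e; have := sle p q; rewrite pq qs nth_index // => /(_ isT).
  have e2 : i' = i.+1 :> nat by move: wp; rewrite nw // e.
  set y : cell a := @box i' (Ordinal (pos _ (ltn_ord i'))).
  have := h1 x y erefl erefl; rewrite /row_of /= e2 ltnSn => /(_ isT) xy.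
  have yy : T y <= T (box j').
    rewrite -(nth_row_entries T j') -nth_row_entries.
    by apply: (sorted_leq_nth leq_trans leqnn 0 (h2 i')); rewrite // inE size_row_entries.
  have := leq_trans xy yy; rewrite ltnNge => /negP h; rewrite e => /orP[/ltnW //|].
  by case/andP => /eqP E _; apply/h/eq_leq/E.
Qed.

(** Zip the word with [row_word b] and fill row [i] with the entries that are
    paired with [i].  Since the word weakly decreases on each block of [b], the
    biword [z] is sorted, and first occurrences in increasing order must lie in
    different blocks. *)
Lemma reading_word_surj (w : seq nat) :
  w \in [seq w <- immaculate_words a | all (mem (set_of_comp b)) (descents w)] ->
  exists2 T : tableau, immaculate T & reading_word T = w.
Proof.
rewrite mem_filter => /andP[/allP wb wa].
have /andP[a0 _] := partsP a; have /andP[b0 _] := partsP b.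
set r := row_word b; set z := zip r w.
have sw : size w = n by rewrite (immaculate_size wa) sum_parts.
have sr : size r = n by rewrite size_row_word sum_parts.
have srw : size r = size w by rewrite sr sw.
have sz : size z = n by rewrite size_zip sr sw minnn.
have z1 : unzip1 z = r by rewrite unzip1_zip // srw.
have z2 : unzip2 z = w by rewrite unzip2_zip // srw.
have nz p : nth (0, 0) z p = (nth 0 r p, nth 0 w p) by rewrite nth_zip.
have zs : sorted biword_le z.
  apply/(sortedP (0, 0)) => p; rewrite sz !nz => pz; rewrite /biword_le /=.
  have := sorted_leq_nth leq_trans leqnn 0 (sorted_row_word b).
  move=> /(_ p p.+1); rewrite !inE -/r sr => /(_ (ltnW pz) pz (leqnSn p)).
  rewrite leq_eqVlt => /orP[/eqP e|->//]; rewrite e eqxx ltnn /=.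
  rewrite leqNgt; apply/negP => d.
  have /wb : p.+1 \in descents w by rewrite mem_descents sw pz /= d.
  by rewrite inE /= -descents_row_word mem_descents /= -/r e ltnn andbF.
pose row i := [seq q.1 | q <- z & q.2 == i].
have size_row i : size (row i) = nth 0 a i.
  rewrite size_map size_filter -(immaculate_count wa) -z2 count_map.
  exact: eq_count.
have row_lt (x : cell a) : nth 0 (row (row_of x)) (col_of x) < size b.
  have : nth 0 (row (row_of x)) (col_of x) \in row (row_of x).
    by apply: mem_nth; rewrite size_row; case: x => i j; rewrite ltn_ord.
  case/mapP => q; rewrite mem_filter => /andP[_ /(map_f fst)] + ->.
  by rewrite -/(unzip1 z) z1 (immaculate_mem b0 (row_word_immaculate b0)).
pose T : tableau := [ffun x => Ordinal (row_lt x)].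
have rowT i : row_entries T i = row i.
  apply: (@eq_from_nth _ 0) => [|j]; rewrite size_row_entries ?size_row // => ji.
  by rewrite (nth_row_entries T (Ordinal ji)) ffunE.
have pT : perm_eq (pairs T) z.
  apply/allP => -[k i] _ /=; apply/eqP.
  case: (ltnP i (size a)) => ia; last first.
    have -> : count_mem (k, i) (pairs T) = 0.
      apply/count_memPn/negP => /mapP[[i' j'] _ [_ e]].
      by have := ltn_ord i'; rewrite ltnNge; case/negP; rewrite e in ia.
    apply/esym/count_memPn/negP => /(map_f snd).
    by rewrite -/(unzip2 z) z2 (immaculate_mem a0 wa) /= ltnNge ia.
  rewrite -(count_row_entries T (Ordinal ia)) rowT /row count_map count_filter.
  by apply: eq_count => -[k' i'] /=; rewrite xpair_eqE.
have sT : sort biword_le (pairs T) = z.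
  apply: (sorted_eq biword_le_trans biword_le_anti) => //.
    exact/sort_sorted/biword_le_total.
  by rewrite perm_sort.
exists T; last by rewrite /reading_word sT.
apply/immaculateP; split.
- move=> [i j] [i' j']; rewrite /row_of /col_of /= => j0 j0' ii.
  rewrite -!nth_row_entries !rowT j0 j0' /row !head_row ?(immaculate_mem a0 wa) //.
  have lt : index (i : nat) w < index (i' : nat) w.
    by apply: (immaculate_index wa); rewrite ii ltn_ord.
  have im : index (i' : nat) w < size z.
    by rewrite sz -[X in _ < X]sw index_mem (immaculate_mem a0 wa).
  have := sorted_leq_nth biword_le_trans biword_le_refl (0, 0) zs _ _
    (ltn_trans lt im) im (ltnW lt).
  rewrite !nz !nth_index ?(immaculate_mem a0 wa) // => /orP[//|/andP[_]].
  by rewrite leqNgt ii.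
- move=> i; rewrite rowT /row sorted_map; apply: sub_sorted (sorted_filter _ _ zs).
    by move=> [x1 x2] [y1 y2]; rewrite /biword_le /=; lia.
  exact: biword_le_trans.
- by rewrite -/r -z1; apply: perm_map.
Qed.

(** Standardization: a tableau of content [b] is a standard one all of whose
    descents lie in the set of [b]. *)
Lemma immaculate_kostkaE : immaculate_kostka a b =
  count (fun w => all (mem (set_of_comp b)) (descents w)) (immaculate_words a).
Proof.
rewrite -size_filter /immaculate_kostka cardE -(size_map reading_word).
apply/perm_size/uniq_perm.
- rewrite map_inj_in_uniq ?enum_uniq // => T T'; rewrite !mem_enum !inE => hT hT'.
  exact: reading_word_inj.
- exact/filter_uniq/uniq_immaculate_words.
- move=> w; apply/mapP/idP => [[T]|/reading_word_surj[T hT <-]].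
    by rewrite mem_enum inE => /reading_word_mem hT ->.
  by exists T; rewrite // mem_enum inE.
Qed.

End Kostka.

(** * Expansion in the fundamental basis *)

Lemma set_of_comp_inj n (a b : composition n) :
  set_of_comp a =i set_of_comp b -> a = b.
Proof.
have /andP[sa _] := set_of_compP a; have /andP[sb _] := set_of_compP b.
move=> e; apply: val_inj; rewrite /= -(set_of_compK a) -(set_of_compK b).
by rewrite (irr_sorted_eq ltn_trans ltnn sa sb e).
Qed.

Lemma set_of_comp_range n (a : composition n) (p : nat) :
  p \in set_of_comp a -> 0 < p < n.
Proof. by have /andP[_ /allP] := set_of_compP a; apply. Qed.

Lemma size_set_of_comp n (a : composition n) :
  0 < n -> size a = (size (set_of_comp a)).+1.
Proof.
move=> n0; rewrite size_map size_iota prednK //; case: a => -[|x s] //= /andP[_] /=.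
by move=> /eqP e; rewrite -e in n0.
Qed.

Lemma partial_sum_mem n (a : composition n) (p j : nat) :
  0 < p < n -> p = sumn (take j a) -> p \in set_of_comp a.
Proof.
move=> /andP[p0 pn] e; apply/mem_set_of_comp; exists j => //.
case: (posnP j) => [j0|_]; first by rewrite e j0 take0 in p0.
by case: (ltnP j (size a)) => // /take_oversize ja; rewrite e ja sum_parts ltnn in pn.
Qed.

(** Cut [b] at the first partial sum of [a], and go on with the rest. *)
Lemma refines_partial_sums (a b : seq nat) : sumn b = sumn a ->
  (forall i, exists j, sumn (take i a) = sumn (take j b)) -> 0 \notin b -> refines b a.
Proof.
elim: a b => [|x a IH] b /= sb h b0; apply/asboolP.
  by exists [::] => //; apply/nilP; rewrite /nilp -leqn0 -sb size_le_sumn.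
have [j] := h 1; rewrite /= take0 addn0 => xj.
have dj : sumn (drop j b) = sumn a.
  by move: sb; rewrite -{1}(cat_take_drop j b) sumn_cat -xj => /addnI.
have : refines (drop j b) a.
  apply: IH => // [i|]; last by apply: contraNN b0 => /mem_drop.
  have [k] := h i.+1; rewrite /= xj; case: (leqP j k) => jk.
    by rewrite -(subnKC jk) takeD sumn_cat => /addnI ->; exists (k - j).
  rewrite -(cat_take_drop k (take j b)) take_takel ?(ltnW jk) // sumn_cat => e.
  by exists 0; rewrite take0 /=; lia.
case/asboolP => bs e1 e2; exists (take j b :: bs); first by rewrite /= -e1 cat_take_drop.
by rewrite /= -xj -e2.
Qed.

Lemma refinesE n (b a : composition n) :
  refines b a = all (mem (set_of_comp b)) (set_of_comp a).
Proof.
have /andP[b0 _] := partsP b; have /andP[a0 _] := partsP a.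
apply/idP/allP => [/asboolP[bs eb ea] p pa | h].
  have pn := set_of_comp_range pa; move/mem_set_of_comp: pa => [i _ pE].
  apply: (@partial_sum_mem _ b p (size (flatten (take i bs))) pn).
  rewrite pE ea -map_take -sumn_flatten eb -{3}(cat_take_drop i bs) flatten_cat.
  by rewrite take_size_cat.
apply: refines_partial_sums b0; first by rewrite !sum_parts.
move=> i; case: (posnP i) => [->|i0]; first by exists 0; rewrite !take0.
case: (ltnP i (size a)) => ia; last first.
  by exists (size b); rewrite take_size take_oversize // !sum_parts.
have /h : sumn (take i a) \in set_of_comp a by apply/mem_set_of_comp; exists i; rewrite ?i0.
by case/mem_set_of_comp => j _ ->; exists j.
Qed.

Lemma descents_ltP n w : is_subset n [seq p <- descents w | p < n].
Proof.
apply/andP; split; last first.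
  by apply/allP => p; rewrite mem_filter mem_descents => /andP[-> /andP[/andP[->]]].
apply: (sorted_filter ltn_trans); have /andP[] // := descentsP (erefl (size w)).
Qed.

(** Keeping only the positions below [n] yields a composition of [n] for a word of
    any length. *)
Definition descent_comp n (w : seq nat) : composition n :=
  Composition (comp_of_setP (descents_ltP n w)).

Lemma set_descent_comp n w : size w = n ->
  set_of_comp (descent_comp n w) = descents w.
Proof.
move=> wn; rewrite /= (comp_of_setK (descents_ltP n w)).
by apply/all_filterP/allP => p; rewrite mem_descents wn => /andP[/andP[]].
Qed.

Definition descent_comps n (a : composition n) : seq (composition n) :=
  [seq descent_comp n w | w <- immaculate_words a].

Section FundamentalExpansion.

Local Open Scope ring_scope.

(** Expand the Kostka numbers by [immaculate_kostkaE] and exchange the sums: for a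
    given word, the compositions whose set contains its descents are the
    refinements of its descent composition. *)
Lemma dual_immaculateE n (a : composition n) :
  dual_immaculate a = \sum_(g <- descent_comps a) fundamentalQ g.
Proof.
have /andP[a0 _] := partsP a.
rewrite big_map /dual_immaculate /fundamentalQ (exchange_big_dep predT) //=.
apply: eq_bigr => b _; rewrite immaculate_kostkaE -big_filter.
rewrite big_const_seq count_predT size_filter -Monoid.iteropE /=.
rewrite -[iterop _ _ _ _]/(_ *+ _); congr (_ *+ _).
apply: eq_in_count => w wa.
rewrite -[RHS]/(refines b (descent_comp n w)) refinesE set_descent_comp //.
by rewrite (immaculate_size wa) sum_parts.
Qed.

Lemma span_sumF n (s : seq (composition n)) :
  QSym (\sum_(g <- s) fundamentalQ g).
Proof. by apply/QSymF/span_sum => g _; apply: span_gen. Qed.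

Lemma linext_sum s n (gs : seq (composition n)) :
  linext s (\sum_(g <- gs) fundamentalQ g) = \sum_(g <- gs) fundamentalQ (s n g).
Proof.
elim: gs => [|g gs IH].
  rewrite !big_nil; apply: (addrI (linext s 0)).
  by rewrite -linextD ?addr0 //; apply/QSymF/span0.
by rewrite !big_cons linextD ?linextF ?IH //; [apply/QSymF/span_gen | apply: span_sumF].
Qed.

Lemma linext_dual_immaculate s n (a : composition n) :
  linext s (dual_immaculate a) = \sum_(g <- [seq s n g | g <- descent_comps a]) fundamentalQ g.
Proof. by rewrite dual_immaculateE linext_sum [RHS]big_map. Qed.

(** The parts are compared as lists, since the coefficients of [lincomb] are
    indexed by compositions of all degrees. *)
Lemma sumF_lincomb n (gs : seq (composition n)) :
  \sum_(g <- gs) fundamentalQ g =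
  lincomb fundamentalQ n.+1
    (fun m b => (count (fun g : composition n => parts g == parts b) gs)%:Z).
Proof.
elim: gs => [|g gs IH].
  rewrite big_nil /lincomb big1 // => m _; rewrite big1 // => b _; exact: mulr0z.
rewrite big_cons IH -(lincomb_delta fundamentalQ g) lincombD maxnn.
apply: lincomb_ext => m b; rewrite /trunc /=; case: ltnP => //= _.
by rewrite PoszD eq_sym.
Qed.

(** Both sides have nonnegative coefficients before scaling, so nothing cancels
    and linear independence identifies the supports. *)
Lemma sumF_supp n (gs hs : seq (composition n)) (z : int) : z != 0 ->
  \sum_(g <- gs) fundamentalQ g = (\sum_(g <- hs) fundamentalQ g) *~ z -> gs =i hs.
Proof.
move=> z0; rewrite !sumF_lincomb.
have -> c : lincomb fundamentalQ n.+1 c *~ z =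
    lincomb fundamentalQ n.+1 (fun m b => c m b * z).
  rewrite /lincomb mulrz_suml; apply: eq_bigr => m _.
  by rewrite mulrz_suml; apply: eq_bigr => b _; rewrite mulrzA.
move/fundamentalQ_free => E g; have := E n g; rewrite /trunc ltnSn.
have c (s : seq (composition n)) :
    count (fun h : composition n => parts h == parts g) s = count_mem g s.
  by apply: eq_count => h; rewrite /= -val_eqE.
rewrite !c => e; rewrite -!has_pred1 !has_count.
case: (posnP (count_mem g hs)) e => [->|p]; first by rewrite mul0r; case: (count_mem g gs).
by case: (posnP (count_mem g gs)) => // -> /esym /eqP; rewrite mulf_eq0 (negbTE z0) orbF; lia.
Qed.

(** What the sequel uses of the one-term property: it compares the sets of descent
    compositions of two shapes, and forgets multiplicities. *)
Lemma one_term_supp s n (a : composition n) : one_term n (linext s (dual_immaculate a)) ->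
  exists b : composition n, [seq s n g | g <- descent_comps a] =i descent_comps b.
Proof.
case=> c; rewrite linext_dual_immaculate => e [b [cb ub]]; exists b.
apply: (sumF_supp cb); rewrite e (bigD1 b) //= big1 ?addr0 ?dual_immaculateE // => b' b'b.
by case: (eqVneq (c b') 0) => [->|/ub bb']; [exact: mulr0z | rewrite bb' eqxx in b'b].
Qed.

Lemma one_term_dual_immaculate n (b : composition n) : one_term n (dual_immaculate b).
Proof.
exists (fun b' => (b' == b)%:Z).
  rewrite (bigD1 b) //= eqxx mulr1z big1 ?addr0 // => b' /negbTE ->; exact: mulr0z.
by exists b; split=> [|b']; rewrite ?eqxx //; case: (b' =P b) => [->|_]; rewrite ?eqxx.
Qed.

End FundamentalExpansion.

(** * Sets of the reverse, the complement and the transpose *)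

Lemma mem_set_compl n (a : composition n) (p : nat) :
  (p \in set_of_comp (compl_comp a)) = (0 < p < n) && (p \notin set_of_comp a).
Proof.
rewrite /= (comp_of_setK (compl_setP n _)) mem_filter mem_iota andbC.
by congr (_ && _); lia.
Qed.

Lemma mem_set_rev n (a : composition n) (p : nat) :
  (p \in set_of_comp (rev_comp a)) = (0 < p < n) && (n - p \in set_of_comp a).
Proof.
have sub (c : composition n) q : q \in set_of_comp c -> n - q \in set_of_comp (rev_comp c).
  move=> qc; have qn := set_of_comp_range qc; move/mem_set_of_comp: qc => [i _ qE].
  apply: (@partial_sum_mem _ _ _ (size c - i)); first by lia.
  rewrite /= take_rev -{1}(sum_parts c) -{1}(cat_take_drop i c) sumn_cat -qE addKn sumn_rev.
  have [ic|ic] := leqP i (size c); first by rewrite subKn.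
  by move: qn; rewrite qE take_oversize ?(ltnW ic) // sum_parts; lia.
apply/idP/andP => [pa|[pn /sub]]; last by rewrite subKn //; lia.
split; first exact: set_of_comp_range pa.
have := sub _ _ pa; rewrite (_ : rev_comp (rev_comp a) = a) //.
by apply: val_inj; rewrite /= revK.
Qed.

Lemma mem_set_transpose n (a : composition n) (p : nat) :
  (p \in set_of_comp (transpose_comp a)) = (0 < p < n) && (n - p \notin set_of_comp a).
Proof.
rewrite mem_set_rev mem_set_compl; case: (boolP (0 < p < n)) => //= h.
by rewrite (_ : 0 < n - p < n); [|lia].
Qed.

Lemma rev_compK n : involutive (@rev_comp n).
Proof. by move=> a; apply: val_inj; rewrite /= revK. Qed.

Lemma compl_compK n : involutive (@compl_comp n).
Proof.
move=> a; apply: set_of_comp_inj => p; rewrite !mem_set_compl.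
case: (boolP (0 < p < n)) => [_|h]; first by rewrite /= negbK.
by apply/esym/negbTE; apply: contraNN h => /set_of_comp_range.
Qed.

Lemma transpose_compK n : involutive (@transpose_comp n).
Proof.
move=> a; apply: set_of_comp_inj => p; rewrite !mem_set_transpose.
case: (boolP (0 < p < n)) => [h|h].
  by rewrite (_ : 0 < n - p < n) ?subKn ?negbK //=; lia.
by apply/esym/negbTE; apply: contraNN h => /set_of_comp_range.
Qed.

Lemma size_rev_comp n (a : composition n) : size (rev_comp a) = size a.
Proof. by rewrite /= size_rev. Qed.

Lemma size_compl_comp n (a : composition n) : 0 < n ->
  size (compl_comp a) + size a = n.+1.
Proof.
move=> n0; rewrite !size_set_of_comp // (comp_of_setK (compl_setP n _)).
have -> : size (set_of_comp a) = count (mem (set_of_comp a)) (iota 1 n.-1).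
  have /andP[sa _] := set_of_compP a; rewrite -size_filter; congr size.
  apply: (irr_sorted_eq ltn_trans ltnn) => //.
    exact/(sorted_filter ltn_trans)/iota_ltn_sorted.
  move=> p; rewrite mem_filter mem_iota; apply/idP/andP => [pa|[]//].
  by split=> //; have := set_of_comp_range pa; lia.
have := count_predC (mem (set_of_comp a)) (iota 1 n.-1).
rewrite size_iota /compl_set size_filter.
set u := count _ _; set v := count _ _; lia.
Qed.

Lemma size_transpose_comp n (a : composition n) : 0 < n ->
  size (transpose_comp a) + size a = n.+1.
Proof. by move=> n0; rewrite size_rev_comp size_compl_comp. Qed.

(** * Hooks *)

Lemma bottom_compP n l : l < n -> is_composition n ((n - l) :: nseq l 1).
Proof.
move=> ln; rewrite /is_composition in_cons mem_nseq /= sumn_nseq.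
by apply/andP; split; [rewrite andbF orbF|]; lia.
Qed.

Lemma top_compP n l : l < n -> is_composition n (rcons (nseq l 1) (n - l)).
Proof.
move=> ln; rewrite /is_composition mem_rcons in_cons mem_nseq sumn_rcons sumn_nseq.
by apply/andP; split; [rewrite andbF orbF|]; lia.
Qed.

Definition bottom_comp n l (ln : l < n) : composition n := Composition (bottom_compP ln).
Definition top_comp n l (ln : l < n) : composition n := Composition (top_compP ln).

Lemma sum_eq_size (s : seq nat) : 0 \notin s -> sumn s <= size s -> s = nseq (size s) 1.
Proof.
elim: s => //= x s IH; rewrite in_cons negb_or => /andP[x0 s0] h.
have := size_le_sumn s0; have := IH s0; move: x0; case: x h => [|[|x]] //= h _; last by lia.
by move=> IH' _; congr (_ :: _); apply: IH'; lia.
Qed.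

(** The rows above the first one have [n - head 0 a] cells in total, so this says
    that they are too few to have more than one cell each. *)
Lemma bottom_hook_head n (a : composition n) : 0 < n ->
  n < head 0 a + size a -> exists l (ln : l < n), a = bottom_comp ln.
Proof.
case: a => -[|x s] /= h n0; first by have /andP[_ /eqP /=] := h; lia.
move=> hn; have := h; rewrite {1}/is_composition in_cons negb_or.
move=> /andP[/andP[x0 s0] /eqP /= sn].
have ln : size s < n by have := size_le_sumn s0; lia.
exists (size s), ln; apply: val_inj => /=.
by rewrite {1}(@sum_eq_size s) //; [congr (_ :: _); have := size_le_sumn s0|]; lia.
Qed.

Lemma top_hook_last n (a : composition n) : 0 < n ->
  n < last 0 a + size a -> exists l (ln : l < n), a = top_comp ln.
Proof.
case: a => s; case/lastP: s => [|s x] /= h n0; first by have /andP[_ /eqP /=] := h; lia.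
rewrite last_rcons size_rcons => hn.
have := h; rewrite {1}/is_composition mem_rcons in_cons negb_or sumn_rcons.
move=> /andP[/andP[x0 s0] /eqP /= sn].
have ln : size s < n by have := size_le_sumn s0; lia.
exists (size s), ln; apply: val_inj => /=.
by rewrite {1}(@sum_eq_size s) //; [congr rcons; have := size_le_sumn s0|]; lia.
Qed.

Lemma bottom_hookP n (a : composition n) : 0 < n ->
  bottom_hook a <-> exists l (ln : l < n), a = bottom_comp ln.
Proof.
move=> n0; split=> [h|[l [ln ->]]].
  apply: bottom_hook_head => //; case: h => [->|[k [l [k2 e]]]].
    by rewrite size_nseq; case: (n) n0 => //= m _; lia.
  by have := sum_parts a; rewrite e /= sumn_nseq size_nseq; lia.
case: (eqVneq l.+1 n) => [e|ne]; [left | right].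
  by rewrite /= -e subSnn.
by exists (n - l), l; split=> //; lia.
Qed.

Lemma top_hookP n (a : composition n) : 0 < n ->
  top_hook a <-> exists l (ln : l < n), a = top_comp ln.
Proof.
move=> n0; split=> [h|[l [ln ->]]].
  apply: top_hook_last => //; case: h => [->|[k [l [k2 e]]]].
    by rewrite size_nseq; case: (n) n0 => //= m _; rewrite (_ : last _ _ = 1) //; elim: m.
  by have := sum_parts a; rewrite e sumn_rcons sumn_nseq last_rcons size_rcons size_nseq; lia.
case: (eqVneq l.+1 n) => [e|ne]; [left | right].
  by rewrite /= -e subSnn -cats1 -[l.+1]addn1 nseqD.
by exists (n - l), l; split=> //; lia.
Qed.

Lemma set_bottom_comp n l (ln : l < n) (p : nat) :
  (p \in set_of_comp (bottom_comp ln)) = (n - l <= p < n).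
Proof.
have e i : i <= l -> sumn (take i.+1 (bottom_comp ln)) = n - l + i.
  by move=> il; rewrite /= take_nseq // sumn_nseq mul1n.
apply/idP/idP => [pa|/andP[p1 p2]].
  rewrite (andP (set_of_comp_range pa)).2 andbT.
  case/mem_set_of_comp: pa => -[|i] //=; rewrite size_nseq => hi ->.
  by rewrite leq_addr.
apply: (@partial_sum_mem _ _ _ (p - (n - l)).+1); first by lia.
by rewrite e; lia.
Qed.

Lemma set_top_comp n l (ln : l < n) (p : nat) :
  (p \in set_of_comp (top_comp ln)) = (0 < p <= l).
Proof.
have e i : i <= l -> sumn (take i (top_comp ln)) = i.
  by move=> il; rewrite /= -cats1 takel_cat ?size_nseq // take_nseq // sumn_nseq mul1n.
apply/idP/idP => [/mem_set_of_comp[i]|/andP[p1 p2]].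
  by rewrite /= size_rcons size_nseq => hi; rewrite e; lia.
apply: (@partial_sum_mem _ _ _ p); first by lia.
by rewrite e.
Qed.

Lemma transpose_bottom_comp n l (ln : l < n) (ln' : n - l.+1 < n) :
  transpose_comp (bottom_comp ln) = bottom_comp ln'.
Proof.
by apply: set_of_comp_inj => p; rewrite mem_set_transpose !set_bottom_comp; lia.
Qed.

Lemma transpose_top_comp n l (ln : l < n) (ln' : n - l.+1 < n) :
  transpose_comp (top_comp ln) = top_comp ln'.
Proof.
by apply: set_of_comp_inj => p; rewrite mem_set_transpose !set_top_comp; lia.
Qed.

Lemma index_count1 (w : seq nat) (q : nat) : q < size w ->
  count_mem (nth 0 w q) w = 1 -> index (nth 0 w q) w = q.
Proof.
move=> qw c; apply/eqP; rewrite eqn_leq index_nth //= leqNgt; apply/negP => h.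
have : 0 < count_mem (nth 0 w q) (take q w).
  by rewrite -has_count has_pred1 in_take // mem_nth.
move: c; rewrite -{2}(cat_take_drop q w) count_cat (drop_nth 0) //= eqxx; lia.
Qed.


(** Only the last row has more than one cell.  A strict decrease in a word would
    thus put the only occurrence of a smaller letter after a larger letter. *)
Lemma top_comp_words n l (ln : l < n) :
  immaculate_words (top_comp ln) = [:: row_word (top_comp ln)].
Proof.
set a := top_comp ln; have /andP[a0 _] := partsP a.
have sa : size a = l.+1 by rewrite /= size_rcons size_nseq.
apply/perm_small_eq => //; apply: uniq_perm => //; first exact: uniq_immaculate_words.
move=> w; rewrite inE; apply/idP/eqP => [aw|->]; last exact: row_word_immaculate.
apply: (sorted_eq leq_trans anti_leq); last exact: immaculate_perm aw.
- rewrite sorted_pairwise; last exact: leq_trans.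
  apply/(pairwiseP 0) => p q; rewrite !inE => pw qw pq.
  rewrite leqNgt; apply/negP => lt.
  have lp : nth 0 w p <= l by have := immaculate_nth a0 aw pw; rewrite sa.
  have qi : index (nth 0 w q) w = q.
    have c1 : count_mem (nth 0 w q) w = 1.
      rewrite (immaculate_count aw) /= nth_rcons size_nseq nth_nseq.
      by rewrite (_ : nth 0 w q < l) //; lia.
    exact: index_count1.
  have := @immaculate_index _ _ aw (nth 0 w q) (nth 0 w p).
  have := index_nth 0 pw; rewrite qi sa lt /=; lia.
- exact: sorted_row_word.
Qed.

(** * Words of bottom-aligned hooks *)

(** The word that puts the successive letters [c], [c + 1], and so on, of the leg
    of a bottom-aligned hook at the positions marked by [m], and zeros elsewhere. *)
Fixpoint hook_word (c : nat) (m : bitseq) : seq nat :=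
  if m is b :: m' then
    if b then c :: hook_word c.+1 m' else 0 :: hook_word c m'
  else [::].

Lemma size_hook_word c m : size (hook_word c m) = size m.
Proof. by elim: m c => //= -[] m IH c /=; rewrite IH. Qed.

Lemma nth_hook_word c m p :
  nth 0 (hook_word c m) p = if nth false m p then c + count id (take p m) else 0.
Proof.
elim: m c p => [|b m IH] c [|p] //=.
  by case: b; rewrite /= ?addn0.
by case: b; rewrite /= IH ?addSnnS.
Qed.

Lemma count_hook_word c m i : 0 < c -> count_mem i (hook_word c m) =
  if i == 0 then size m - count id m else (c <= i < c + count id m) : nat.
Proof.
elim: m c => [|[] m IH] c c0 /=.
- by rewrite addn0; case: eqP; lia.
- rewrite IH //; case: (eqVneq i 0) => [->|i0]; first by rewrite gtn_eqF //=; lia.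
  by case: (eqVneq c i) => ci; lia.
- rewrite IH // (eq_sym 0 i); case: (eqVneq i 0) => _ //=.
  by have := count_size id m; lia.
Qed.

Lemma index_hook_word c m i j : 0 < c -> c <= i < j -> j < c + count id m ->
  index i (hook_word c m) < index j (hook_word c m).
Proof.
elim: m c => [|[] m IH] c c0 /=; first by lia.
  move=> ij jm; case: (eqVneq c i) => ci; first by case: eqP; lia.
  by rewrite (_ : c == j = false) ?ltnS ?IH; lia.
by move=> ij jm; rewrite !ifN ?ltnS ?IH; lia.
Qed.

Lemma eq_hook_word c (w : seq nat) : 0 < c ->
  [seq x <- w | x != 0] = iota c (count (predC1 0) w) -> w = hook_word c [seq x != 0 | x <- w].
Proof.
elim: w c => //= x w IH c c0; case: eqVneq => [->|x0] /=.
  by move=> /(IH _ c0) <-.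
by case=> -> /(IH c.+1 isT) <-.
Qed.

Section Bottom.

Variables (n l : nat) (ln : l < n).
Notation a := (bottom_comp ln).

Definition descent_mask (D : seq nat) : bitseq := [seq p \in D | p <- iota 0 n].

Lemma count_mask (D : seq nat) : uniq D -> {in D, forall p, 0 < p < n} ->
  count id (descent_mask D) = size D.
Proof.
move=> uD Dn; rewrite count_map -size_filter; apply/perm_size/uniq_perm => //.
  exact/filter_uniq/iota_uniq.
move=> p; rewrite mem_filter mem_iota /=; apply/andP/idP => [[]//|pD].
by split=> //; have /andP[] := Dn _ pD.
Qed.

Lemma nth_bottom (i : nat) : nth 0 a i = if i == 0 then n - l else (i <= l) : nat.
Proof. by case: i => //= i; rewrite nth_nseq; case: ltnP. Qed.

(** The nonzero letters occur once each, so they are first occurrences, hence come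
    in increasing order and lie exactly at the descents. *)
Lemma bottom_word_eq (w : seq nat) : w \in immaculate_words a ->
  w = hook_word 1 (descent_mask (descents w)).
Proof.
move=> aw; have /andP[a0 _] := partsP a.
have wn : size w = n by rewrite (immaculate_size aw) sum_parts.
have ci := immaculate_count aw.
have one k : k < size w -> nth 0 w k != 0 -> count_mem (nth 0 w k) w = 1.
  move=> kw k0; rewrite ci nth_bottom (negbTE k0).
  by have := immaculate_nth a0 aw kw; rewrite /= size_nseq ltnS => ->.
have mE : [seq x != 0 | x <- w] = descent_mask (descents w).
  apply: (@eq_from_nth _ false) => [|p]; rewrite !size_map ?size_iota // => pw.
  rewrite !(nth_map 0) ?size_iota ?nth_iota -?wn // add0n.
  apply/idP/idP => [wp0|]; last by rewrite mem_descents => /andP[_]; lia.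
  rewrite -(index_count1 pw (one _ pw wp0)).
  by apply: (index_mem_descents a0 aw); rewrite lt0n wp0 (immaculate_nth a0 aw).
rewrite -mE; apply: eq_hook_word => //; set r := [seq x <- w | x != 0].
have cr i : count_mem i r = (0 < i <= l).
  rewrite count_filter; case: (eqVneq i 0) => [->|i0].
    by rewrite (@eq_count _ _ pred0) ?count_pred0 // => x /=; case: eqP.
  rewrite (@eq_count _ _ (pred1 i)) ?ci ?nth_bottom; last first.
    by move=> x /=; case: (eqVneq x i) => [->|].
  by rewrite (negbTE i0) lt0n i0.
have pr : perm_eq r (iota 1 l).
  apply/allP => i _; rewrite /= cr count_uniq_mem ?iota_uniq // mem_iota add1n ltnS //.
have -> : count (predC1 0) w = l by rewrite -size_filter (perm_size pr) size_iota.
apply: (sorted_eq leq_trans anti_leq _ _ pr); last exact: iota_sorted.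
have pw : pairwise (fun x y => (x != 0) ==> (y != 0) ==> (x <= y)) w.
  apply/(pairwiseP 0) => p q; rewrite !inE => hp hq pq.
  apply/implyP => p0; apply/implyP => q0.
  apply: (immaculate_index_le aw);
    by rewrite ?(immaculate_nth a0 aw) // !index_count1 ?one // ltnW.
rewrite sorted_pairwise; last exact: leq_trans.
apply: (@sub_in_pairwise _ [pred x | x != 0] _ _ _ r _ (pairwise_filter _ pw)).
  by move=> x y; rewrite !inE /= => -> ->.
exact: filter_all.
Qed.

Lemma hook_word_mem (D : seq nat) : uniq D -> size D = l -> {in D, forall p, 0 < p < n} ->
  hook_word 1 (descent_mask D) \in immaculate_words a /\
  descents (hook_word 1 (descent_mask D)) =i D.
Proof.
move=> uD sD Dn; set m := descent_mask D.
have sm : size m = n by rewrite size_map size_iota.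
have nm p : p < n -> nth false m p = (p \in D).
  by move=> pn; rewrite (nth_map 0) ?size_iota // nth_iota.
have cm : count id m = l by rewrite count_mask.
have m0 : nth false m 0 = false.
  by rewrite nm; [apply/negbTE/negP => /Dn | lia].
split.
  rewrite mem_immaculate_words; apply/andP; split.
    apply/perm_row_wordP => i; rewrite count_hook_word // cm sm nth_bottom.
    by case: eqP => // i0; rewrite add1n ltnS; congr nat_of_bool; lia.
  apply/allP => i; rewrite mem_iota /= size_nseq add0n => il.
  case: i il => [|i] il; last by apply: index_hook_word; rewrite ?cm; lia.
  have := nth_hook_word 1 m 0; rewrite m0.
  have : size (hook_word 1 m) = n by rewrite size_hook_word.
  have : 0 < count_mem 1 (hook_word 1 m) by rewrite count_hook_word // cm /=; lia.
  case: (hook_word 1 m) => [|x s] //= _ _ x0; first by rewrite x0.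
move=> p; rewrite mem_descents size_hook_word sm !nth_hook_word.
case: (boolP (0 < p < n)) => [pn|pn] /=; last first.
  by apply/esym/negbTE; apply: contraNN pn => /Dn.
rewrite (nm p); last by lia.
case: (boolP (p \in D)) => pD; last by rewrite ltn0.
case: ifP => // pD'; have p1 : p.-1 < size m by rewrite sm; lia.
have {2}-> : p = p.-1.+1 by lia.
rewrite (take_nth false p1) -cats1 count_cat /= pD'; lia.
Qed.

(** A standard tableau of bottom-aligned hook shape is an arbitrary choice of the
    leg among the entries above 1, and its descents record this choice. *)
Lemma perm_bottom_descent_comps :
  perm_eq (descent_comps a)
    [seq g : composition n <- index_enum (composition n) | size g == l.+1].
Proof.
have n0 : 0 < n by lia.
apply: uniq_perm; last 1 first.
- move=> g; rewrite mem_filter mem_index_enum andbT.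
  apply/mapP/eqP => [[w aw ->]|gl].
    have wn : size w = n by rewrite (immaculate_size aw) sum_parts.
    have uD : uniq (descents w) by apply/filter_uniq/iota_uniq.
    have Dn : {in descents w, forall p, 0 < p < n}.
      by move=> p; rewrite mem_descents wn => /andP[].
    rewrite size_set_of_comp // set_descent_comp // -count_mask //.
    have := immaculate_count aw 0; rewrite {1}(bottom_word_eq aw) count_hook_word //.
    have := count_size id (descent_mask (descents w)); rewrite size_map size_iota /=; lia.
  have /andP[sg _] := set_of_compP g.
  have [|||h1 h2] := @hook_word_mem (set_of_comp g).
  + exact: sorted_uniq ltn_trans ltnn _ sg.
  + by have := size_set_of_comp g n0; rewrite gl => -[].
  + by move=> p /set_of_comp_range.
  exists (hook_word 1 (descent_mask (set_of_comp g))) => //.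
  apply: set_of_comp_inj => p; rewrite set_descent_comp ?h2 //.
  by rewrite size_hook_word size_map size_iota.
- rewrite map_inj_in_uniq ?uniq_immaculate_words // => w w' aw aw' e.
  rewrite (bottom_word_eq aw) (bottom_word_eq aw').
  have wn : size w = n by rewrite (immaculate_size aw) sum_parts.
  have wn' : size w' = n by rewrite (immaculate_size aw') sum_parts.
  by rewrite -(set_descent_comp wn) e set_descent_comp.
- exact/filter_uniq/index_enum_uniq.
Qed.

End Bottom.

(** * Dual immaculate functions with a one-term image *)

Section DescentComps.

Variables (n : nat) (n0 : 0 < n).
Implicit Types a b g : composition n.

Lemma descent_compsP a g : g \in descent_comps a ->
  exists w, [/\ w \in immaculate_words a, size w = n & set_of_comp g = descents w].
Proof.
case/mapP => w aw ->; have wn : size w = n by rewrite (immaculate_size aw) sum_parts.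
by exists w; rewrite set_descent_comp.
Qed.

Lemma mem_descent_comps a w : w \in immaculate_words a ->
  exists2 g, g \in descent_comps a & set_of_comp g = descents w.
Proof.
move=> aw; have wn : size w = n by rewrite (immaculate_size aw) sum_parts.
by exists (descent_comp n w); [apply: map_f | rewrite set_descent_comp].
Qed.

Lemma descent_comps_refl a : a \in descent_comps a.
Proof.
have /andP[a0 _] := partsP a.
have [g ga e] := mem_descent_comps (row_word_immaculate a0).
have ag : a = g by apply: set_of_comp_inj => p; rewrite e descents_row_word.
by rewrite {1}ag.
Qed.

Lemma descent_comps_size a g : g \in descent_comps a -> size a <= size g.
Proof.
have /andP[a0 _] := partsP a; case/descent_compsP => w [aw wn e].
by have := size_descents_ge a0 aw; rewrite -e (size_set_of_comp g n0); lia.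
Qed.

Lemma descent_comps_head a g m : g \in descent_comps a -> m <= n ->
  (forall p : nat, 0 < p < m -> p \notin set_of_comp g) -> m <= head 0 a.
Proof.
have /andP[a0 _] := partsP a; case/descent_compsP => w [aw wn ->].
by move=> mn; apply: (no_descent_le a0 aw); rewrite wn.
Qed.

Lemma descent_comps_run a g q r : g \in descent_comps a -> 0 < q -> q + r <= n ->
  (forall p : nat, q <= p < q + r -> p \in set_of_comp g) -> r < size a.
Proof.
have /andP[a0 _] := partsP a; case/descent_compsP => w [aw wn ->] q0 qr h.
by apply: (descent_run a0 aw q0 _ h); rewrite wn.
Qed.

Lemma descent_comps_initial a : exists2 g, g \in descent_comps a &
  forall p : nat, (p \in set_of_comp g) = (0 < p < size a).
Proof.
have /andP[a0 _] := partsP a; have [w aw h] := exists_initial_descents a0.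
by have [g ga e] := mem_descent_comps aw; exists g => // p; rewrite e.
Qed.

Lemma descent_comps_two_parts a (i j : nat) :
  (forall g, g \in descent_comps a -> size g <= size a) ->
  j < i < size a -> 1 < nth 0 a i -> nth 0 a j = 1.
Proof.
move=> h ij ai; have /andP[a0 _] := partsP a.
have jl : j < size a by lia.
have j0 : nth 0 a j != 0 by apply: contraNneq a0 => <-; rewrite mem_nth.
suff : ~~ (1 < nth 0 a j) by lia.
apply/negP => aj; have [w aw le] := exists_extra_descent a0 ij ai aj.
have [g /h ga e] := mem_descent_comps aw.
by move: ga; rewrite (size_set_of_comp g n0) e; lia.
Qed.

Lemma dual_immaculate_bottom a : bottom_hook a ->
  dual_immaculate a = (\sum_(g : composition n | size g == size a) fundamentalQ g)%R.
Proof.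
case/bottom_hookP => // l [ln ->]; rewrite dual_immaculateE.
by rewrite (perm_big _ (perm_bottom_descent_comps ln)) big_filter /= size_nseq.
Qed.

Lemma dual_immaculate_top a : top_hook a -> dual_immaculate a = fundamentalQ a.
Proof.
case/top_hookP => // l [ln ->]; rewrite dual_immaculateE /descent_comps top_comp_words.
rewrite big_seq1; congr fundamentalQ; apply: set_of_comp_inj => p.
by rewrite set_descent_comp ?size_row_word ?sum_parts // descents_row_word.
Qed.

Lemma transpose_bottom_hook a : bottom_hook a -> bottom_hook (transpose_comp a).
Proof.
case/bottom_hookP => // l [ln ->]; apply/bottom_hookP => //.
have ln' : n - l.+1 < n by lia.
by exists (n - l.+1), ln'; apply: transpose_bottom_comp.
Qed.

Lemma transpose_top_hook a : top_hook a -> top_hook (transpose_comp a).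
Proof.
case/top_hookP => // l [ln ->]; apply/top_hookP => //.
have ln' : n - l.+1 < n by lia.
by exists (n - l.+1), ln'; apply: transpose_top_comp.
Qed.

(** For a bottom-aligned hook the sum runs over all compositions of a given length,
    so that an involution on compositions only changes the condition on the length. *)
Lemma linext_bottom (s : forall m, composition m -> composition m) a :
  involutive (@s n) -> bottom_hook a ->
  linext s (dual_immaculate a) =
  (\sum_(g : composition n | size (s n g) == size a) fundamentalQ g)%R.
Proof.
move=> sK ha; rewrite dual_immaculate_bottom // -big_filter linext_sum big_filter.
rewrite [RHS](reindex_inj (inv_inj sK)) /=.
by apply: eq_bigl => g; rewrite sK.
Qed.

Lemma rho_bottom a : bottom_hook a -> rho (dual_immaculate a) = dual_immaculate a.
Proof.
move=> ha; rewrite /rho linext_bottom //; last exact: rev_compK.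
by rewrite dual_immaculate_bottom //; apply: eq_bigl => g; rewrite size_rev_comp.
Qed.

Lemma psi_bottom a : bottom_hook a ->
  psi (dual_immaculate a) = dual_immaculate (transpose_comp a).
Proof.
move=> ha; rewrite /psi linext_bottom //; last exact: compl_compK.
rewrite dual_immaculate_bottom; last exact: transpose_bottom_hook.
apply: eq_bigl => g; have := size_compl_comp g n0; have := size_transpose_comp a n0; lia.
Qed.

Lemma omega_bottom a : bottom_hook a ->
  omega (dual_immaculate a) = dual_immaculate (transpose_comp a).
Proof.
move=> ha; rewrite /omega linext_bottom //; last exact: transpose_compK.
rewrite dual_immaculate_bottom; last exact: transpose_bottom_hook.
apply: eq_bigl => g; have := size_transpose_comp g n0; have := size_transpose_comp a n0; lia.
Qed.

Lemma omega_top a : top_hook a ->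
  omega (dual_immaculate a) = dual_immaculate (transpose_comp a).
Proof.
move=> ha; rewrite dual_immaculate_top // /omega linextF.
by rewrite dual_immaculate_top //; exact: transpose_top_hook.
Qed.

Lemma bottom_hook_of_head a : n < head 0 a + size a -> bottom_hook a.
Proof. by move=> h; apply/bottom_hookP => //; apply: bottom_hook_head. Qed.

Lemma top_hook_of_last a : n < last 0 a + size a -> top_hook a.
Proof. by move=> h; apply/top_hookP => //; apply: top_hook_last. Qed.

(** The shape [b] is at most as long as [a], because [rev_comp a] is among its
    descent compositions.  Reversing the composition of [b] with set
    [1, size b - 1] shows that [a] has a tableau without descents below
    [n + 1 - size b]; hence its first row is too long for any shape of this length
    but a hook. *)
Lemma rho_supp_bottom a b :
  [seq rev_comp g | g <- descent_comps a] =i descent_comps b -> bottom_hook a.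
Proof.
move=> e; apply: bottom_hook_of_head.
have ba : size b <= size a.
  rewrite -(size_rev_comp a); apply: descent_comps_size.
  by rewrite -e map_f // descent_comps_refl.
have [g] := descent_comps_initial b; rewrite -e => /mapP[h ha ->] gE.
suff H : n.+1 - size b <= head 0 a by lia.
have b0 : 0 < size b by rewrite (size_set_of_comp b n0).
apply: (descent_comps_head ha); first by lia.
move=> p hp; have := gE (n - p); rewrite mem_set_rev subKn; last by lia.
by case: (p \in _) => //; lia.
Qed.

(** The complement of [1, size b - 1] is the set of descents of a tableau of shape
    [a].  It has no element below [size b], which makes the first row long, and
    ends with a run of [n - size b] descents, which makes [a] long. *)
Lemma psi_supp_bottom a b :
  [seq compl_comp g | g <- descent_comps a] =i descent_comps b -> bottom_hook a.
Proof.
move=> e; apply: bottom_hook_of_head.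
have [g] := descent_comps_initial b; rewrite -e => /mapP[h ha ->] gE.
have b0 : 0 < size b by rewrite (size_set_of_comp b n0).
have bn := size_parts_le b.
have H1 : size b <= head 0 a.
  apply: (descent_comps_head ha bn) => p hp; have := gE p.
  by rewrite mem_set_compl hp => /andP[].
have H2 : n - size b < size a.
  apply: (descent_comps_run ha b0); first by lia.
  by move=> p hp; have := gE p; rewrite mem_set_compl; case: (p \in _) => //; lia.
by lia.
Qed.

(** The transpose of the composition of [b] with set [1, size b - 1] has the set
    [1, n - size b], which is a run of descents for the shape [a]; so the lengths
    of [a] and [b] add up to at least [n + 1].  Since the descent compositions of
    [b] are at least as long as [b], those of [a] are then at most as long as [a]. *)
Lemma omega_supp_size a b :
  [seq transpose_comp g | g <- descent_comps a] =i descent_comps b ->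
  n < size a + size b /\ forall g, g \in descent_comps a -> size g <= size a.
Proof.
move=> e; have [g] := descent_comps_initial b; rewrite -e => /mapP[h ha ->] gE.
have b0 : 0 < size b by rewrite (size_set_of_comp b n0).
have bn := size_parts_le b.
have H : n - size b < size a.
  apply: (descent_comps_run ha (ltn0Sn 0)); first by lia.
  move=> p hp; have := gE (n - p); rewrite mem_set_transpose subKn; last by lia.
  by case: (p \in _) => //; lia.
split=> [|k ka]; first by lia.
have := @descent_comps_size b (transpose_comp k); rewrite -e map_f // => /(_ isT).
by have := size_transpose_comp k n0; lia.
Qed.

Lemma head_bottom_hook a :
  (forall g, g \in descent_comps a -> size g <= size a) -> 1 < head 0 a -> bottom_hook a.
Proof.
move=> h a1; apply: bottom_hook_of_head; have := descent_comps_two_parts h.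
have /andP[+ /eqP] := partsP a; case: (parts a) a1 => //= x s x1.
rewrite in_cons negb_or => /andP[_ s0] sn two.
suff e : s = nseq (size s) 1 by move: sn; rewrite {1}e sumn_nseq; lia.
apply: (@eq_from_nth _ 0); rewrite ?size_nseq // => i hi; rewrite nth_nseq hi.
have := two i.+1 0; rewrite /= ltnS hi => /(_ isT).
have : nth 0 s i != 0 by apply: contraNneq s0 => <-; rewrite mem_nth.
lia.
Qed.

Lemma last_top_hook a :
  (forall g, g \in descent_comps a -> size g <= size a) -> 1 < last 0 a -> top_hook a.
Proof.
move=> h a1; apply: top_hook_of_last; have := descent_comps_two_parts h.
have /andP[_ /eqP] := partsP a; case/lastP: (parts a) a1 => //= s x.
rewrite last_rcons size_rcons sumn_rcons => x1 sn two.
suff e : s = nseq (size s) 1 by move: sn; rewrite {1}e sumn_nseq; lia.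
apply: (@eq_from_nth _ 0); rewrite ?size_nseq // => i hi; rewrite nth_nseq hi.
have := two (size s) i; rewrite !nth_rcons ltnn eqxx hi ltnSn; exact.
Qed.

(** By [omega_supp_size] and [descent_comps_two_parts], each of [a] and [b] has at
    most one part above 1, and [a] is a hook if this part comes first or last.
    Otherwise, if [n > 1], the last part of [a] is 1 and [n - 1] is in the set of
    [a], so that 1 is not in that of its transpose, and the first part of [b] is
    above 1: thus [b] is a bottom-aligned hook.  Its transpose is a descent
    composition of [a] and has no descent in [1, size b - 1], which forces a long
    first part of [a]. *)
Lemma omega_supp_hook a b :
  [seq transpose_comp g | g <- descent_comps a] =i descent_comps b ->
  bottom_hook a \/ top_hook a.
Proof.
move=> e; have [ab ha] := omega_supp_size e.
have e' : [seq transpose_comp g | g <- descent_comps b] =i descent_comps a.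
  have inj := inv_inj (@transpose_compK n).
  by move=> g; rewrite -{1}[g]transpose_compK (mem_map inj) -e (mem_map inj).
have [_ hb] := omega_supp_size e'.
have [a1|a1] := ltnP 1 (head 0 a); first by left; apply: head_bottom_hook.
have [a2|a2] := ltnP 1 (last 0 a); first by right; apply: last_top_hook.
left; apply: bottom_hook_of_head.
have b1 : n <= 1 \/ 1 < head 0 b.
  case: (leqP n 1) => n1; [by left | right].
  have ta : transpose_comp a \in descent_comps b by rewrite -e map_f // descent_comps_refl.
  apply: (descent_comps_head ta n1) => p hp.
  rewrite mem_set_transpose negb_and negbK; apply/orP; right.
  rewrite (_ : n - p = n.-1); last by lia.
  apply: (@partial_sum_mem _ _ _ (size a).-1); first by lia.
  have /andP[+ /eqP] := partsP a; case/lastP: (parts a) a2 => [|s x] /=; first by lia.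
  rewrite mem_rcons in_cons negb_or last_rcons size_rcons sumn_rcons -cats1.
  by rewrite take_size_cat // => x1 /andP[x0 _] <-; lia.
have a0 : 0 < head 0 a + (size a).-1.
  have /andP[+ /eqP] := partsP a; case: (parts a) => [|x s] /=; first by lia.
  by rewrite in_cons negb_or => /andP[x0 _] _; lia.
have sa : 0 < size a by rewrite (size_set_of_comp a n0).
case: b1 => [n1|]; first by lia.
move/(head_bottom_hook hb)/(bottom_hookP _ n0) => [l [ln bE]].
have tb : transpose_comp b \in descent_comps a by rewrite -e' map_f // descent_comps_refl.
suff : l.+1 <= head 0 a by move: ab; rewrite bE /= size_nseq; lia.
apply: (descent_comps_head tb ln) => p hp.
by rewrite bE mem_set_transpose set_bottom_comp; lia.
Qed.

End DescentComps.

Theorem theorem7p1 (n : nat) (hn : (0 < n)%N) (a : composition n) :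
  [/\ forall f : power_series -> power_series, f = rho \/ f = psi ->
        (one_term n (f (dual_immaculate a)) <-> bottom_hook a),
      bottom_hook a ->
        rho (dual_immaculate a) = dual_immaculate a /\
        psi (dual_immaculate a) = dual_immaculate (transpose_comp a),
      one_term n (omega (dual_immaculate a)) <-> bottom_hook a \/ top_hook a
    & bottom_hook a \/ top_hook a ->
        omega (dual_immaculate a) = dual_immaculate (transpose_comp a)].
Proof.
have om : bottom_hook a \/ top_hook a ->
    omega (dual_immaculate a) = dual_immaculate (transpose_comp a).
  by case; [exact: omega_bottom | exact: omega_top].
split=> //.
- move=> f [] ->; split.
  + by case/one_term_supp => b; apply: rho_supp_bottom.
  + by move=> h; rewrite rho_bottom //; apply: one_term_dual_immaculate.
  + by case/one_term_supp => b; apply: psi_supp_bottom.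
  + by move=> h; rewrite psi_bottom //; apply: one_term_dual_immaculate.
- by move=> h; split; [exact: rho_bottom | exact: psi_bottom].
- split; last by move=> /om ->; apply: one_term_dual_immaculate.
  by case/one_term_supp => b; apply: omega_supp_hook.
Qed.
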